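(* Let $k\geq 1$ and let $\mathcal P=\{P_1,\dots,P_k\}\subset\mathbb Z[t]$ be a collection of linearly independent polynomials with zero constant terms. Then for every $\varepsilon>0$ there exists $p_0=p_0(\varepsilon,\mathcal P)$ such that, for every prime $p\geq p_0$ and every $A\subseteq\mathbb F_p$, writing $\alpha=\mathbb E_{x\in\mathbb F_p}1_A(x)=|A|/p$, there exists $d\in\mathbb F_p\setminus\{0\}$ such that \[ \mathbb E_{x\in\mathbb F_p}1_A(x)\prod_{i=1}^k 1_A\bigl(x+P_i(d)\bigr)^{\omega_i}\ \geq\ \alpha^{\,1+\sum_{i=1}^k\omega_i}-\varepsilon \] holds simultaneously for every $\omega=(\omega_1,\dots,\omega_k)\in\{0,1\}^k$.
   Context: For a finite set $X$, $\mathbb E_{x\in X}f(x):=\frac1{|X|}\sum_{x\in X}f(x)$. $1_A$ is the indicator function of $A$. Polynomials in $\mathbb Z[t]$ are evaluated at elements of $\mathbb F_p$ by reducing coefficients modulo $p$. Linear independence of integer polynomials is over $\mathbb Q$. A factor raised to the power $\omega_i=0$ is interpreted as $1$ (the factor is omitted). *)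

(* Defs.v *)
From mathcomp Require Import all_boot all_order all_algebra.
From mathcomp Require Import reals.

Set Implicit Arguments.
Unset Strict Implicit.
Unset Printing Implicit Defensive.

Import Order.TTheory GRing.Theory Num.Theory.
Local Open Scope ring_scope.

Definition avg (R : realType) (T : finType) (X : {set T}) (f : T -> R) : R :=
  (#|X|%:R)^-1 * \sum_(x in X) f x.

Definition ind (R : realType) (T : finType) (A : {set T}) (x : T) : R :=
  (x \in A)%:R.

(* [map_poly intr] reduces the integer coefficients modulo [p]. *)
Definition evalp (p : nat) (P : {poly int}) (d : 'F_p) : 'F_p :=
  (map_poly (intr : int -> 'F_p) P).[d].

(* The library's [free] needs a finite-dimensional ambient space, which
   {poly rat} is not, so independence is spelled out. *)
Definition lin_indep (k : nat) (P : 'I_k -> {poly int}) : Prop :=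
  forall c : 'I_k -> rat,
    \sum_(i < k) c i *: map_poly (intr : int -> rat) (P i) = 0 ->
    forall i, c i = 0.

(* Main.v *)
(** For affinely independent polynomials [Q_i] modulo constants, the average of
    [prod_i f_i (x + Q_i(d))] over [x] and [d] is close to the product of the
    means of the [f_i], uniformly in the family. This goes by induction on the
    number of [f_i] that are not characters: if one of these has mean zero,
    the average is bounded by a Gowers norm of a dual function (PET induction),
    and the degree of this norm can be lowered, because a large norm would make
    the dual function correlate with nontrivial characters, which the induction
    hypothesis forbids (Peluse's degree lowering). With only one [f_i] that is
    not a character, the average is a Weyl sum.

    Applied to products of translates of [1_A], this says that all joint moments
    of the pattern counts at [(P_1(d), ..., P_k(d))], for uniform [d], agree
    asymptotically with those at a uniform point [r] of [F_p^k]. Ramsey's theorem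
    shows that, with probability bounded below independently of [p] and [A], all
    counts at [r] are at least [alpha^(1 + |omega|) - eps / 2]; a polynomial
    approximating a threshold function then transfers this to some [d]. *)

Require Import Defs.
From mathcomp Require Import all_boot all_order all_algebra.
From mathcomp Require Import reals boolp complex ring lra.

Set Implicit Arguments.
Unset Strict Implicit.
Unset Printing Implicit Defensive.

Import Order.TTheory GRing.Theory Num.Theory.
Local Open Scope ring_scope.

(** * Averages *)

(** The mean over [d] of each single count is already close to the right value, but different
    [omega] could be good at different [d]; one [d] for all of them requires the joint law of the
    counts. Moments see this law only through polynomials, so the event that all counts are large is
    replaced by a polynomial whose degree and coefficients depend on [eps] and [k] alone; a fixed
    accuracy of the moments then serves every [p] and [A]. A product of counts is a mean of
    correlations with more general weights, which is why independence is proved for arbitrary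
    bounded functions. Multiples of characters are the functions whose box derivatives are of the
    same kind, so the number of other functions does not grow under degree lowering and can carry
    the induction. Only qualitative bounds are needed, so every induction may lose exponents and
    constants freely, as long as they do not depend on [p]. *)

Definition mean (K : fieldType) (T : finType) (f : T -> K) : K :=
  #|T|%:R^-1 * \sum_x f x.

Section Mean.
Variables (K : numFieldType) (T : finType).
Implicit Types f g : T -> K.

Lemma eq_mean f g : f =1 g -> mean f = mean g.
Proof. by move=> fg; rewrite /mean (eq_bigr g). Qed.

Lemma meanD f g : mean (fun x => f x + g x) = mean f + mean g.
Proof. by rewrite /mean big_split mulrDr. Qed.

Lemma meanMl c f : mean (fun x => c * f x) = c * mean f.
Proof. by rewrite /mean -mulr_sumr mulrCA. Qed.

Lemma meanMr c f : mean (fun x => f x * c) = mean f * c.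
Proof. by rewrite /mean -mulr_suml mulrA. Qed.

Lemma meanN f : mean (fun x => - f x) = - mean f.
Proof. by rewrite /mean sumrN mulrN. Qed.

Lemma meanB f g : mean (fun x => f x - g x) = mean f - mean g.
Proof. by rewrite meanD meanN. Qed.

Lemma mean_sum (I : Type) (r : seq I) (P : pred I) (F : I -> T -> K) :
  mean (fun x => \sum_(i <- r | P i) F i x) = \sum_(i <- r | P i) mean (F i).
Proof. by rewrite /mean exchange_big mulr_sumr. Qed.

Lemma mean_exchange (U : finType) (f : T -> U -> K) :
  mean (fun x => mean (f x)) = mean (fun y => mean (f^~ y)).
Proof.
by rewrite /mean -!mulr_sumr mulrCA exchange_big.
Qed.

Lemma mean_bij (h : T -> T) f : bijective h -> mean (fun x => f (h x)) = mean f.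
Proof.
move=> hb; rewrite /mean; congr (_ * _).
by rewrite [RHS](reindex h) //; apply: onW_bij.
Qed.

Lemma mean_pair (U : finType) (f : T * U -> K) :
  mean f = mean (fun x => mean (fun y => f (x, y))).
Proof.
rewrite /mean -mulr_sumr mulrA card_prod natrM invfM; congr (_ * _).
by rewrite pair_big; apply: eq_bigr => -[].
Qed.

Lemma ler_mean f g : (forall x, f x <= g x) -> mean f <= mean g.
Proof.
by move=> fg; rewrite /mean ler_wpM2l ?invr_ge0 ?ler0n// ler_sum.
Qed.

Lemma mean_ge0 f : (forall x, 0 <= f x) -> 0 <= mean f.
Proof. by move=> f0; rewrite /mean mulr_ge0 ?invr_ge0 ?ler0n// sumr_ge0. Qed.

Hypothesis T0 : (0 < #|T|)%N.

Lemma mean_cst (c : K) : mean (fun _ : T => c) = c.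
Proof.
rewrite /mean sumr_const -[c *+ _]mulr_natl mulrA mulVf ?mul1r//.
by rewrite pnatr_eq0 -lt0n.
Qed.

Lemma mean_le_cst f c : (forall x, f x <= c) -> mean f <= c.
Proof. by move=> fc; rewrite -[leRHS]mean_cst ler_mean. Qed.

End Mean.

Lemma mean_prod2 (K : numFieldType) (T U : finType) (f : T -> K) (g : U -> K) :
  mean (fun x => mean (fun y => f x * g y)) = mean f * mean g.
Proof. by under eq_mean do rewrite meanMl; rewrite meanMr. Qed.

(* The tangent line of [t ^ n.+1] at [a]. *)
Lemma tangent_pow (R : realFieldType) (n : nat) (a y : R) : 0 <= a -> 0 <= y ->
  a ^+ n.+1 + n.+1%:R * a ^+ n * (y - a) <= y ^+ n.+1.
Proof.
move=> a0 y0; elim: n => [|n IH]; first by rewrite !expr1 expr0; lra.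
have [an yn] : 0 <= a ^+ n /\ 0 <= y ^+ n by rewrite !exprn_ge0.
rewrite [y ^+ n.+2]exprS.
apply: le_trans (ler_wpM2l y0 IH).
rewrite -subr_ge0.
have -> : y * (a ^+ n.+1 + n.+1%:R * a ^+ n * (y - a)) -
  (a ^+ n.+2 + n.+2%:R * a ^+ n.+1 * (y - a)) =
  n.+1%:R * (a ^+ n * (y - a) ^+ 2).
  by rewrite [a ^+ n.+2]exprS [a ^+ n.+1]exprS -[n.+2%:R]natr1; ring.
by rewrite mulr_ge0 ?ler0n// mulr_ge0 ?sqr_ge0.
Qed.

(** Jensen's inequality: average the tangent line at [mean f], whose linear term has mean zero. *)
Lemma mean_pow (R : realFieldType) (T : finType) (n : nat) (f : T -> R) :
  (0 < #|T|)%N -> (forall x, 0 <= f x) -> mean f ^+ n <= mean (fun x => f x ^+ n).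
Proof.
case: n => [|n] T0 f0; first by rewrite expr0 (mean_cst T0).
have m0 := mean_ge0 f0.
apply: le_trans (ler_mean (fun x => tangent_pow n m0 (f0 x))).
by rewrite meanD (mean_cst T0) meanMl meanB (mean_cst T0) subrr mulr0 addr0.
Qed.

(** * The real-valued modulus on [R[i]] *)

Definition nm (R : realType) (z : R[i]) : R := complex.Re `|z|.

Section Nm.
Variable R : realType.
Local Notation C := R[i].
Implicit Types z w : C.
Local Notation rc := (real_complex R).

Lemma nmE z : `|z| = rc (nm z).
Proof. by rewrite /nm [RHS]RRe_real// normr_real. Qed.

Lemma rc_inj : injective rc. Proof. exact: fmorph_inj. Qed.

Lemma rc_le (x y : R) : (rc x <= rc y) = (x <= y).
Proof. exact: lecR. Qed.

Lemma nm_ge0 z : 0 <= nm z.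
Proof. by rewrite -rc_le rmorph0 -nmE normr_ge0. Qed.

Lemma nm0 : nm (0 : C) = 0.
Proof. by apply: rc_inj; rewrite -nmE normr0 rmorph0. Qed.

Lemma nm1 : nm (1 : C) = 1.
Proof. by apply: rc_inj; rewrite -nmE normr1 rmorph1. Qed.

Lemma nmM z w : nm (z * w) = nm z * nm w.
Proof. by apply: rc_inj; rewrite rmorphM -!nmE normrM. Qed.

Lemma nmX z n : nm (z ^+ n) = nm z ^+ n.
Proof. by apply: rc_inj; rewrite rmorphXn -!nmE normrX. Qed.

Lemma nmN z : nm (- z) = nm z.
Proof. by apply: rc_inj; rewrite -!nmE normrN. Qed.

Lemma nm_conj z : nm (z^*) = nm z.
Proof. by apply: rc_inj; rewrite -!nmE norm_conjC. Qed.

Lemma nmD z w : nm (z + w) <= nm z + nm w.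
Proof. by rewrite -rc_le rmorphD -!nmE ler_normD. Qed.

Lemma nmB z w : nm (z - w) <= nm z + nm w.
Proof. by rewrite -[nm w]nmN nmD. Qed.

Lemma nm_rc x : nm (rc x) = `|x|.
Proof.
apply: rc_inj; rewrite -nmE; have [x0|x0] := ger0P x.
  by rewrite ger0_norm // -[0](rmorph0 rc) rc_le.
by rewrite ltr0_norm ?rmorphN// -[0](rmorph0 rc) ltcR.
Qed.

Lemma nm_sum (I : Type) (r : seq I) (P : pred I) (f : I -> C) :
  nm (\sum_(i <- r | P i) f i) <= \sum_(i <- r | P i) nm (f i).
Proof.
elim/big_rec2: _ => [|i y1 y2 _ ih]; first by rewrite nm0.
by apply: le_trans (nmD _ _) _; rewrite lerD2l.
Qed.

Lemma nm_prod (I : Type) (r : seq I) (P : pred I) (f : I -> C) :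
  nm (\prod_(i <- r | P i) f i) = \prod_(i <- r | P i) nm (f i).
Proof. by elim/big_rec2: _ => [|i y1 y2 _ <-]; rewrite ?nm1 ?nmM. Qed.

Lemma nm_prod_le1 (I : Type) (r : seq I) (P : pred I) (f : I -> C) :
  (forall i, P i -> nm (f i) <= 1) -> nm (\prod_(i <- r | P i) f i) <= 1.
Proof.
by move=> f1; rewrite nm_prod prodr_ile1// => i Pi; rewrite nm_ge0 f1.
Qed.

Lemma nmM_le1 z w : nm z <= 1 -> nm w <= 1 -> nm (z * w) <= 1.
Proof. by move=> z1 w1; rewrite nmM -[1]mulr1 ler_pM ?nm_ge0. Qed.

Lemma conj_rc x : (rc x)^* = rc x.
Proof. exact: conjc_real. Qed.

Lemma conjM z w : (z * w)^* = z^* * w^*.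
Proof. exact: rmorphM. Qed.

Lemma mul_conj z : z * z^* = rc (nm z ^+ 2).
Proof. by rewrite -normCK nmE rmorphXn. Qed.

Lemma rc_mean (T : finType) (f : T -> R) : rc (mean f) = mean (fun x => rc (f x)).
Proof. by rewrite /mean rmorphM fmorphV rmorph_nat rmorph_sum. Qed.

Lemma conj_mean (T : finType) (f : T -> C) : (mean f)^* = mean (fun x => (f x)^*).
Proof. by rewrite /mean rmorphM fmorphV rmorph_nat rmorph_sum. Qed.

Lemma nm_mean (T : finType) (f : T -> C) : nm (mean f) <= mean (fun x => nm (f x)).
Proof.
rewrite /mean nmM -(rmorph_nat rc) -fmorphV nm_rc ger0_norm ?invr_ge0 ?ler0n//.
by rewrite ler_wpM2l ?invr_ge0 ?ler0n ?nm_sum.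
Qed.

Lemma nm_mean_le1 (T : finType) (f : T -> C) : (0 < #|T|)%N ->
  (forall x, nm (f x) <= 1) -> nm (mean f) <= 1.
Proof. by move=> T0 f1; apply: le_trans (nm_mean _) _; apply: mean_le_cst. Qed.

Lemma nm_sqr_mean (T : finType) (f : T -> C) :
  rc (nm (mean f) ^+ 2) = mean (fun x => mean (fun y => f x * (f y)^*)).
Proof. by rewrite -mul_conj conj_mean mean_prod2. Qed.

Lemma nm_mean_sqr (T : finType) (b g : T -> C) : (0 < #|T|)%N ->
  (forall x, nm (b x) <= 1) ->
  nm (mean (fun x => b x * g x)) ^+ 2 <= mean (fun x => nm (g x) ^+ 2).
Proof.
move=> T0 b1; apply: (@le_trans _ _ (mean (fun x => nm (g x)) ^+ 2)); last first.
  by apply: mean_pow => // x; apply: nm_ge0.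
rewrite lerXn2r ?nnegrE ?nm_ge0 ?mean_ge0 ?nm_ge0// => [x|]; first exact: nm_ge0.
apply: le_trans (nm_mean _) _; apply: ler_mean => x.
by rewrite nmM ler_piMl ?nm_ge0.
Qed.

End Nm.

(** * Averages over sequences and the box Cauchy-Schwarz inequality *)

(** Plain lists let the recursion peel off one entry without casts; only lists of length [t] are
    ever fed to [f]. *)
Fixpoint Es (K : fieldType) (T : finType) (t : nat) (f : seq T -> K) : K :=
  if t is t'.+1 then mean (fun a => Es t' (fun s => f (a :: s))) else f [::].

Section Es.
Variables (K : numFieldType) (T : finType).
Implicit Types f g : seq T -> K.

Lemma eq_Es t f g : (forall s, size s = t -> f s = g s) -> Es t f = Es t g.
Proof.
elim: t f g => [|t IH] f g fg /=; first exact: fg.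
by apply: eq_mean => a; apply: IH => s st; apply: fg; rewrite /= st.
Qed.

Lemma EsMl t c f : Es t (fun s => c * f s) = c * Es t f.
Proof. by elim: t f => //= t IH f; rewrite -meanMl; apply: eq_mean => a; rewrite IH. Qed.

Lemma EsD t f g : Es t (fun s => f s + g s) = Es t f + Es t g.
Proof. by elim: t f g => //= t IH f g; rewrite -meanD; apply: eq_mean => a; rewrite IH. Qed.

Lemma Es_mean (U : finType) t (f : U -> seq T -> K) :
  mean (fun y => Es t (f y)) = Es t (fun s => mean (f^~ s)).
Proof.
elim: t f => //= t IH f; rewrite mean_exchange; apply: eq_mean => a.
exact: IH.
Qed.

Lemma ler_Es t f g : (forall s, size s = t -> f s <= g s) -> Es t f <= Es t g.
Proof.
elim: t f g => [|t IH] f g fg /=; first exact: fg.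
by apply: ler_mean => a; apply: IH => s st; apply: fg; rewrite /= st.
Qed.

Lemma Es_ge0 t f : (forall s, 0 <= f s) -> 0 <= Es t f.
Proof. by elim: t f => //= t IH f f0; apply: mean_ge0 => a; apply: IH. Qed.

Hypothesis T0 : (0 < #|T|)%N.

Lemma Es_cst t (c : K) : Es t (fun _ : seq T => c) = c.
Proof. by elim: t => //= t IH; rewrite IH (mean_cst T0). Qed.

End Es.

Lemma Es_pow (R : realFieldType) (T : finType) t n (f : seq T -> R) :
  (0 < #|T|)%N -> (forall s, 0 <= f s) -> Es t f ^+ n <= Es t (fun s => f s ^+ n).
Proof.
move=> T0; elim: t f => //= t IH f f0; apply: le_trans (mean_pow _ T0 _) _.
  by move=> a; apply: Es_ge0.
by apply: ler_mean => a; apply: IH.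
Qed.

Section EsC.
Variables (R : realType) (T : finType).
Local Notation C := R[i].

Lemma nm_Es t (f : seq T -> C) : nm (Es t f) <= Es t (fun s => nm (f s)).
Proof.
elim: t f => //= t IH f; apply: le_trans (nm_mean _) _.
by apply: ler_mean => a; apply: IH.
Qed.

Lemma rc_Es t (f : seq T -> R) :
  real_complex R (Es t f) = Es t (fun s => real_complex R (f s)).
Proof. by elim: t f => //= t IH f; rewrite rc_mean; apply: eq_mean => a; rewrite IH. Qed.

Lemma conj_Es t (f : seq T -> C) : (Es t f)^* = Es t (fun s => (f s)^*).
Proof. by elim: t f => //= t IH f; rewrite conj_mean; apply: eq_mean => a; rewrite IH. Qed.

End EsC.

(** The multiplicative derivative over a box: [l] lists the two ends of each side, and the product
    runs over all vertices, conjugated according to the parity of the number of second ends. *)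
Fixpoint bx (R : realType) (A : Type) (l : seq (A * A)) (f : seq A -> R[i]) : R[i] :=
  if l is (a, b) :: l' then bx l' (fun s => f (a :: s) * (f (b :: s))^*)
  else f [::].

(* [Low t b]: on sequences of length [t], [b] is a product of [t] bounded
   factors, the [i]-th of which does not depend on the [i]-th entry. *)
Fixpoint Low (R : realType) (A X : Type) (t : nat) (b : seq A -> X -> R[i]) : Prop :=
  if t is t'.+1 then
    exists b0 : seq A -> X -> R[i], exists b' : A -> seq A -> X -> R[i],
      [/\ forall s x, nm (b0 s x) <= 1, forall a, Low t' (b' a) &
          forall a s x, b (a :: s) x = b0 s x * b' a s x]
  else forall x, b [::] x = 1.

Section Box.
Variables (R : realType) (A : finType).
Local Notation C := R[i].
Local Notation rc := (real_complex R).

Lemma bxM l (f g : seq A -> C) : bx l (fun s => f s * g s) = bx l f * bx l g.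
Proof.
elim: l f g => //= -[a b] l IH f g; rewrite -IH; congr bx; apply: funext => s.
by rewrite rmorphM mulrACA.
Qed.

Lemma bx_conj l (f : seq A -> C) : bx l (fun s => (f s)^*) = (bx l f)^*.
Proof.
elim: l f => //= -[a b] l IH f; rewrite -IH; congr bx; apply: funext => s.
by rewrite rmorphM.
Qed.

Lemma bx_prod l (I : Type) (r : seq I) (P : pred I) (f : I -> seq A -> C) :
  bx l (fun s => \prod_(i <- r | P i) f i s) = \prod_(i <- r | P i) bx l (f i).
Proof.
elim: r => [|i r IH].
  rewrite (_ : (fun s => _) = fun=> 1); last by apply: funext => s; rewrite big_nil.
  rewrite big_nil; elim: l => //= -[a b] l IH.
  by rewrite (_ : (fun s => _) = fun=> 1)//; apply: funext => s; rewrite rmorph1 mulr1.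
rewrite big_cons -IH; case: ifP => Pi; last by congr bx; apply: funext => s; rewrite big_cons Pi.
by rewrite -bxM; congr bx; apply: funext => s; rewrite big_cons Pi.
Qed.

Lemma bx_le1 l (f : seq A -> C) : (forall s, nm (f s) <= 1) -> nm (bx l f) <= 1.
Proof.
elim: l f => //= -[a b] l IH f f1; apply: IH => s.
by apply: nmM_le1 => //; rewrite nm_conj.
Qed.

Section Low.
Variable X : Type.

Lemma LowM t (b c : seq A -> X -> C) :
  Low t b -> Low t c -> Low t (fun s x => b s x * c s x).
Proof.
elim: t b c => [|t IH] b c /=; first by move=> b1 c1 x; rewrite b1 c1 mulr1.
move=> [b0 [b' [b01 bl be]]] [c0 [c' [c01 cl ce]]].
exists (fun s x => b0 s x * c0 s x), (fun a s x => b' a s x * c' a s x); split.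
- by move=> s x; apply: nmM_le1.
- by move=> a; apply: IH.
- by move=> a s x; rewrite be ce mulrACA.
Qed.

Lemma Low_conj t (b : seq A -> X -> C) : Low t b -> Low t (fun s x => (b s x)^*).
Proof.
elim: t b => [|t IH] b /=; first by move=> b1 x; rewrite b1 rmorph1.
move=> [b0 [b' [b01 bl be]]].
exists (fun s x => (b0 s x)^*), (fun a s x => (b' a s x)^*); split.
- by move=> s x; rewrite nm_conj.
- by move=> a; apply: IH.
- by move=> a s x; rewrite be rmorphM.
Qed.

Lemma Low_comp (Y : Type) (g : Y -> X) t (b : seq A -> X -> C) :
  Low t b -> Low t (fun s y => b s (g y)).
Proof.
elim: t b => [|t IH] b /=; first by move=> b1 x; rewrite b1.
move=> [b0 [b' [b01 bl be]]].
exists (fun s x => b0 s (g x)), (fun a s x => b' a s (g x)); split=> // a.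
exact: IH.
Qed.

End Low.

(** One Cauchy-Schwarz per coordinate: the factor [b0] free of the first entry is dropped, that
    entry is doubled into a pair, and the two copies of the remaining factors again form a [Low]
    product in the other entries. *)
Lemma box_cs (X : finType) t (f b : seq A -> X -> C) :
  (0 < #|A|)%N -> (0 < #|X|)%N -> Low t b ->
  nm (Es t (fun s => mean (fun x => f s x * b s x))) ^+ (2 ^ t) <=
  Es t (fun l : seq (A * A) => nm (mean (fun x => bx l (f^~ x)))).
Proof.
move=> A0 X0; elim: t f b => [|t IH] f b /=.
  by move=> b1; rewrite expr1 (eq_mean (g := f [::]))// => x; rewrite b1 mulr1.
move=> [b0 [b' [b01 bl be]]].
have AA0 : (0 < #|{: A * A}|)%N by rewrite card_prod muln_gt0 A0.
pose H s x := mean (fun a => f (a :: s) x * b' a s x).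
have -> : mean (fun a => Es t (fun s => mean (fun x => f (a :: s) x * b (a :: s) x)))
  = Es t (fun s => mean (fun x => b0 s x * H s x)).
  rewrite Es_mean; apply: eq_Es => s _; rewrite mean_exchange.
  apply: eq_mean => x; rewrite -meanMl; apply: eq_mean => a.
  by rewrite be mulrCA.
pose W (q : A * A) := Es t (fun s => mean (fun x =>
  (f (q.1 :: s) x * (f (q.2 :: s) x)^*) * (b' q.1 s x * (b' q.2 s x)^*))).
pose v := Es t (fun s => mean (fun x => nm (H s x) ^+ 2)).
have v0 : 0 <= v by apply: Es_ge0 => s; apply: mean_ge0 => x; apply: sqr_ge0.
have vW : rc v = mean W.
  rewrite rc_Es mean_pair.
  under [RHS]eq_mean do rewrite Es_mean.
  rewrite Es_mean; apply: eq_Es => s _; rewrite rc_mean.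
  under [RHS]eq_mean do rewrite mean_exchange.
  rewrite mean_exchange; apply: eq_mean => x; rewrite nm_sqr_mean.
  apply: eq_mean => a; apply: eq_mean => a' /=.
  by rewrite rmorphM mulrACA.
have v_le : v <= mean (fun q => nm (W q)).
  by rewrite -[v]ger0_norm// -nm_rc vW nm_mean.
rewrite expnS exprM.
have step : nm (Es t (fun s => mean (fun x => b0 s x * H s x))) ^+ 2 <= v.
  apply: le_trans (_ : Es t (fun s => nm (mean (fun x => b0 s x * H s x))) ^+ 2 <= _).
    by rewrite lerXn2r ?nnegrE ?nm_ge0 ?nm_Es// Es_ge0// => s; apply: nm_ge0.
  apply: le_trans (Es_pow _ _ A0 _) _; first by move=> s; apply: nm_ge0.
  by apply: ler_Es => s _; apply: nm_mean_sqr.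
apply: le_trans (_ : mean (fun q => nm (W q)) ^+ (2 ^ t) <= _).
  rewrite lerXn2r ?nnegrE ?exprn_ge0 ?nm_ge0//.
    by apply: mean_ge0 => q; apply: nm_ge0.
  exact: le_trans step v_le.
apply: le_trans (mean_pow _ AA0 _) _; first by move=> q; apply: nm_ge0.
apply: ler_mean => -[a a']; rewrite /W /=.
apply: le_trans (IH _ _ _) _; last by [].
by apply: LowM => //; apply: Low_conj.
Qed.

End Box.

(** * Gowers norms *)

Lemma Fp_gt0 p : (0 < #|'F_p|)%N.
Proof. by apply/card_gt0P; exists 0. Qed.
#[local] Hint Resolve Fp_gt0 : core.

Section Gowers.
Variables (R : realType) (p : nat).
Local Notation C := R[i].
Local Notation F := 'F_p.
Local Notation rc := (real_complex R).
Implicit Types f g : F -> C.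

Lemma mean_shift (K : numFieldType) (f : F -> K) a :
  mean (fun x => f (x + a)) = mean f.
Proof.
by apply: (mean_bij (h := fun x => x + a)); exists (fun x => x - a) => x;
   rewrite ?addrK ?subrK.
Qed.

Lemma mean_shiftl (K : numFieldType) (f : F -> K) a :
  mean (fun x => f (a + x)) = mean f.
Proof. by rewrite -(mean_shift f a); apply: eq_mean => x; rewrite addrC. Qed.

Lemma mean_sub2 (K : numFieldType) (f : F -> K) :
  mean (fun a => mean (fun b => f (b - a))) = mean f.
Proof. under eq_mean do rewrite mean_shift.
by rewrite (mean_cst (Fp_gt0 p)). Qed.

Lemma Es_shift (K : numFieldType) t a (f : seq F -> K) :
  Es t (fun s => f [seq x + a | x <- s]) = Es t f.
Proof.
elim: t f => //= t IH f; rewrite -[RHS](mean_shift _ a).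
by apply: eq_mean => b; rewrite -[RHS]IH.
Qed.

Definition Dl a f : F -> C := fun x => f x * (f (x + a))^*.

Fixpoint Dls s f : F -> C := if s is a :: s' then Dl a (Dls s' f) else f.

(* [U s f] is the [2 ^ s.+1]-th power of the Gowers norm of [f] of degree
   [s.+1]. *)
Fixpoint U s f : R :=
  if s is s'.+1 then mean (fun a => U s' (Dl a f)) else nm (mean f) ^+ 2.

Lemma Dl_comm a b f : Dl a (Dl b f) = Dl b (Dl a f).
Proof.
apply: funext => x; rewrite /Dl /= !rmorphM /= !conjCK [x + a + b]addrAC.
by rewrite mulrACA.
Qed.

Lemma Dls_Dl s a f : Dls s (Dl a f) = Dl a (Dls s f).
Proof. by elim: s => //= b s ->; rewrite Dl_comm. Qed.

Lemma Dl_le1 a f : (forall x, nm (f x) <= 1) -> forall x, nm (Dl a f x) <= 1.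
Proof. by move=> f1 x; apply: nmM_le1 => //; rewrite nm_conj. Qed.

Lemma Dls_le1 s f : (forall x, nm (f x) <= 1) -> forall x, nm (Dls s f x) <= 1.
Proof. by move=> f1; elim: s => //= a s IH; apply: Dl_le1. Qed.

Lemma U_Es s f : U s f = Es s (fun h => nm (mean (Dls h f)) ^+ 2).
Proof.
elim: s f => //= s IH f; apply: eq_mean => a; rewrite IH.
by apply: eq_Es => h _; rewrite Dls_Dl.
Qed.

Lemma U_ge0 s f : 0 <= U s f.
Proof. by rewrite U_Es Es_ge0// => h; apply: sqr_ge0. Qed.

Lemma nm_mean_Dl f : rc (nm (mean f) ^+ 2) = mean (fun a => mean (Dl a f)).
Proof.
rewrite nm_sqr_mean mean_exchange [RHS]mean_exchange.
under eq_mean do rewrite meanMr.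
rewrite meanMl; under [RHS]eq_mean => x.
  rewrite /Dl meanMl (mean_shiftl (fun y => (f y)^*) x); over.
by rewrite meanMr.
Qed.

Lemma U_sqr s f : U s f ^+ 2 <= U s.+1 f.
Proof.
elim: s f => [|s IH] f.
  have -> : U 0 f = nm (mean (fun a => mean (Dl a f))).
    by rewrite -nm_mean_Dl nm_rc ger0_norm ?sqr_ge0.
  apply: le_trans (mean_pow 2 (Fp_gt0 p) _); last by move=> a; apply: nm_ge0.
  rewrite lerXn2r ?nnegrE ?nm_ge0 ?nm_mean// mean_ge0// => a; exact: nm_ge0.
rewrite [U s.+1 f]/= [U s.+2 f]/=; apply: le_trans (mean_pow 2 (Fp_gt0 p) _) _.
  by move=> a; apply: U_ge0.
by apply: ler_mean => a; apply: IH.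
Qed.

(* Each Cauchy-Schwarz step removes one factor of [b] at the cost of
   replacing [f] by some [Dl u f]. *)
Lemma twisted_U t f (b : seq F -> F -> C) :
  (forall x, nm (f x) <= 1) -> Low t b ->
  nm (Es t (fun s => mean (fun k => mean (Dls s (Dl k f)) * b s k))) ^+ (2 ^ t)
    <= U t f.
Proof.
elim: t f b => [|t IH] f b f1 /=.
  move=> b1; rewrite expr1.
  under eq_mean do rewrite b1 mulr1.
  by rewrite -nm_mean_Dl nm_rc ger0_norm ?sqr_ge0.
move=> [b0 [b' [b01 bl be]]].
have FF0 : (0 < #|{: F * F}|)%N by rewrite card_prod muln_gt0 !Fp_gt0.
pose D s k := Dls s (Dl k f).
have D1 s k x : nm (D s k x) <= 1 by apply: Dls_le1; apply: Dl_le1.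
(* The factor of [Dl a] that is free of [a] joins [b0] in the weight [B]; only the copy shifted by
   [a] gets squared. *)
pose H s k x := mean (fun a => (D s k (x + a))^* * b' a s k).
pose B s (q : F * F) := D s q.1 q.2 * b0 s q.1.
have -> : mean (fun a => Es t (fun s => mean (fun k =>
      mean (Dl a (Dls s (Dl k f))) * b (a :: s) k)))
    = Es t (fun s => mean (fun q : F * F => B s q * H s q.1 q.2)).
  rewrite Es_mean; apply: eq_Es => s _; rewrite mean_exchange mean_pair.
  apply: eq_mean => k; rewrite -[RHS]/(mean (fun x => B s (k, x) * H s k x)).
  under [LHS]eq_mean do rewrite -meanMr.
  rewrite mean_exchange; apply: eq_mean => x; rewrite -meanMl.
  by apply: eq_mean => a; rewrite be /Dl /B /= -/(D s k); ring.
(* The copies shifted by [a] and [a'] recombine, after translating [x], into one derivative in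
   direction [a' - a]. *)
pose W (a a' : F) := Es t (fun s => mean (fun k =>
  mean (Dls s (Dl k (Dl (a' - a) f))) * ((b' a s k)^* * b' a' s k))).
pose v := Es t (fun s => mean (fun q : F * F => nm (H s q.1 q.2) ^+ 2)).
have v0 : 0 <= v by apply: Es_ge0 => s; apply: mean_ge0 => x; apply: sqr_ge0.
have vW : rc v = mean (fun q : F * F => (W q.1 q.2)^*).
  rewrite rc_Es mean_pair.
  under [RHS]eq_mean do under eq_mean do rewrite /= conj_Es.
  under [RHS]eq_mean do rewrite Es_mean.
  rewrite Es_mean; apply: eq_Es => s _; rewrite rc_mean mean_pair.
  transitivity (mean (fun x => mean (fun y => mean (fun k =>
      (mean (Dls s (Dl k (Dl (y - x) f))) * ((b' x s k)^* * b' y s k))^*)))); last first.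
    by do 2!apply: eq_mean => ?; rewrite conj_mean.
  under [RHS]eq_mean do rewrite mean_exchange.
  rewrite [RHS]mean_exchange; apply: eq_mean => k /=.
  under [LHS]eq_mean do rewrite nm_sqr_mean.
  rewrite mean_exchange; apply: eq_mean => a.
  rewrite mean_exchange; apply: eq_mean => a'.
  rewrite conjM conj_mean -meanMr -[RHS](mean_shift _ a).
  apply: eq_mean => x.
  have -> : Dls s (Dl k (Dl (a' - a) f)) = Dl (a' - a) (D s k).
    by rewrite Dl_comm Dls_Dl.
  rewrite /Dl !conjM !conjCK.
  by rewrite -addrA [a + _]addrC subrK; ring.
have v_le : v <= mean (fun q : F * F => nm (W q.1 q.2)).
  rewrite -[v]ger0_norm// -nm_rc vW; apply: le_trans (nm_mean _) _.
  by apply: ler_mean => q; rewrite nm_conj.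
rewrite expnS exprM.
have step : nm (Es t (fun s => mean (fun q => B s q * H s q.1 q.2))) ^+ 2 <= v.
  apply: le_trans (_ : Es t (fun s => nm (mean (fun q => B s q * H s q.1 q.2))) ^+ 2 <= _).
    by rewrite lerXn2r ?nnegrE ?nm_ge0 ?nm_Es// Es_ge0// => s; apply: nm_ge0.
  apply: le_trans (Es_pow _ _ (Fp_gt0 p) _) _; first by move=> s; apply: nm_ge0.
  by apply: ler_Es => s _; apply: nm_mean_sqr => // q; apply: nmM_le1.
apply: le_trans (_ : mean (fun q : F * F => nm (W q.1 q.2)) ^+ (2 ^ t) <= _).
  rewrite lerXn2r ?nnegrE ?exprn_ge0 ?nm_ge0//.
    by apply: mean_ge0 => q; apply: nm_ge0.
  exact: le_trans step v_le.
apply: le_trans (mean_pow _ FF0 _) _; first by move=> q; apply: nm_ge0.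
rewrite mean_pair -(mean_sub2 (fun a => U t (Dl a f))) /=.
apply: ler_mean => a; apply: ler_mean => a'.
apply: IH; first exact: Dl_le1.
by apply: LowM => //; apply: Low_conj.
Qed.

End Gowers.

(** * Characters and degree lowering *)

Definition is_chi (R : realType) (p : nat) (chi : 'F_p -> R[i]) : Prop :=
  [/\ forall a b, chi (a + b) = chi a * chi b, forall a, nm (chi a) = 1 &
      \sum_x chi x = 0].

(** A complex root of [1 + X + ... + X^(n-1)], with [n] the order of ['F_p], is an [n]-th root of
    unity whose powers sum to zero; this sum is what makes the character nontrivial. *)
Lemma chi_exists (R : realType) (p : nat) : exists chi : 'F_p -> R[i], is_chi chi.
Proof.
pose n := (Zp_trunc (pdiv p)).+2.
pose P : {poly R[i]} := \poly_(i < n) 1.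
have sP : size P != 1%N by rewrite size_poly_eq ?oner_eq0.
have /closed_rootP[z /rootP] := sP.
rewrite horner_poly => z0.
have z0' : \sum_(i < n) z ^+ i = 0 by rewrite -[RHS]z0; apply: eq_bigr => i _; rewrite mul1r.
have zn : z ^+ n = 1 by apply/eqP; rewrite -subr_eq0 subrX1 z0' mulr0.
have nz : nm z = 1.
  by apply/eqP; rewrite -(@pexpr_eq1 _ _ n)// ?nm_ge0// -nmX zn nm1.
exists (fun a => z ^+ (a : nat)); split.
- by move=> a b; rewrite -exprD /= expr_mod.
- by move=> a; rewrite nmX nz expr1n.
- exact: z0'.
Qed.

Section Chi.
Variables (R : realType) (p : nat) (chi : 'F_p -> R[i]).
Local Notation C := R[i].
Local Notation F := 'F_p.
Local Notation rc := (real_complex R).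
Hypothesis chiP : is_chi chi.

Lemma chiD a b : chi (a + b) = chi a * chi b. Proof. by case: chiP. Qed.

Lemma nm_chi a : nm (chi a) = 1. Proof. by case: chiP. Qed.

Lemma chi_neq0 a : chi a != 0.
Proof. by apply: contra_eq_neq (nm_chi a) => ->; rewrite nm0 eq_sym oner_eq0. Qed.

Lemma chi0 : chi 0 = 1.
Proof. by apply: (mulfI (chi_neq0 0)); rewrite -chiD addr0 mulr1. Qed.

Lemma chiN a : chi (- a) = (chi a)^*.
Proof.
apply: (mulfI (chi_neq0 a)).
by rewrite -chiD subrr chi0 mul_conj nm_chi expr1n rmorph1.
Qed.

Lemma mean_chi xi : mean (fun x => chi (xi * x)) = (xi == 0)%:R.
Proof.
have [->|xi0] := eqVneq xi 0.
  under eq_mean do rewrite mul0r chi0.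
  by rewrite (mean_cst (Fp_gt0 p)).
rewrite (mean_bij (h := fun x => xi * x) chi).
  by case: chiP => _ _ s0; rewrite /mean s0 mulr0.
by exists (fun x => xi^-1 * x) => x; rewrite ?mulKf ?mulVKf.
Qed.

Lemma sum_chi z : \sum_xi chi (xi * z) = #|F|%:R * (z == 0)%:R.
Proof.
rewrite -mean_chi /mean mulrA divff ?mul1r; last by rewrite pnatr_eq0 -lt0n Fp_gt0.
by apply: eq_bigr => xi _; rewrite mulrC.
Qed.

Definition hat (f : F -> C) xi : C := mean (fun x => f x * chi (xi * x)).

Lemma hat_sqr f xi :
  rc (nm (hat f xi) ^+ 2) = mean (fun h => mean (Dl h f) * (chi (xi * h))^*).
Proof.
rewrite -mul_conj conj_mean -mean_prod2.
under [RHS]eq_mean do rewrite -meanMr.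
rewrite [RHS]mean_exchange; apply: eq_mean => x.
rewrite -[LHS](mean_shiftl _ x); apply: eq_mean => h.
rewrite /Dl conjM -!chiN -[RHS]mulrA mulrA -!mulrA; congr (_ * _).
rewrite mulrCA; congr (_ * _); rewrite -chiD; congr chi.
by rewrite mulrDr; ring.
Qed.

(** Fourier inversion for the autocorrelation of [f]: once the squares are opened, the sum over [xi]
    forces [y = x + h]. *)
Lemma hat_inversion f h :
  mean (Dl h f) = \sum_xi rc (nm (hat f xi) ^+ 2) * chi (xi * h).
Proof.
have -> : \sum_xi rc (nm (hat f xi) ^+ 2) * chi (xi * h) =
    mean (fun x => mean (fun y => f x * (f y)^* * \sum_xi chi (xi * (x - y + h)))).
  under eq_bigr => xi _.
    rewrite -mul_conj conj_mean -mean_prod2 -meanMr.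
    under eq_mean do rewrite -meanMr.
    over.
  rewrite -mean_sum; apply: eq_mean => x; rewrite -mean_sum.
  apply: eq_mean => y; rewrite mulr_sumr; apply: eq_bigr => xi _.
  by rewrite !mulrDr mulrN !chiD chiN !conjM; ring.
apply: eq_mean => x; rewrite -[RHS](mean_shiftl _ (x + h)).
have E y : \sum_xi chi (xi * (x - (x + h + y) + h)) = #|F|%:R * (y == 0)%:R.
  by rewrite (_ : x - (x + h + y) + h = - y) ?sum_chi ?oppr_eq0//; ring.
under eq_mean do rewrite E.
rewrite /mean (bigD1 (0 : F))// ?eqxx big1 => [|y /negPf->]; last by rewrite !mulr0.
rewrite /= !addr0 mulr1 /Dl [RHS]mulrCA mulVf ?mulr1//.
by rewrite pnatr_eq0 -lt0n Fp_gt0.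
Qed.

Lemma U1_hat f : U 1 f = \sum_xi nm (hat f xi) ^+ 2 * nm (hat f xi) ^+ 2.
Proof.
apply: (@rc_inj R); rewrite /= rc_mean rmorph_sum.
under eq_mean => h do rewrite -mul_conj [X in _ * X^*]hat_inversion.
under eq_mean => h.
  rewrite rmorph_sum mulr_sumr.
  under eq_bigr => xi _ do rewrite /= conjM conj_rc mulrCA.
  over.
rewrite mean_sum; apply: eq_bigr => xi _.
by rewrite meanMl -hat_sqr -rmorphM.
Qed.

Lemma sum_hat f : \sum_xi nm (hat f xi) ^+ 2 = mean (fun x => nm (f x) ^+ 2).
Proof.
apply: (@rc_inj R); rewrite rmorph_sum rc_mean.
under [RHS]eq_mean do rewrite -mul_conj.
have := hat_inversion f 0.
under [X in _ = X -> _]eq_bigr do rewrite mulr0 chi0 mulr1.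
by move=> <-; apply: eq_mean => x; rewrite /Dl addr0.
Qed.

Lemma U1_le f M : (forall x, nm (f x) <= 1) ->
  (forall xi, nm (hat f xi) ^+ 2 <= M) -> U 1 f <= M.
Proof.
move=> f1 fM; rewrite U1_hat.
apply: (@le_trans _ _ (\sum_xi M * nm (hat f xi) ^+ 2)).
  by apply: ler_sum => xi _; rewrite ler_wpM2r ?sqr_ge0.
rewrite -mulr_sumr sum_hat ler_piMr//.
  by apply: le_trans (fM 0); apply: sqr_ge0.
by apply: (mean_le_cst (Fp_gt0 p)) => x; rewrite exprn_ile1 ?nm_ge0.
Qed.

(** Inverse theorem for the degree two norm: [U 1 f] is the fourth moment of the Fourier
    coefficients and Parseval bounds their second moment by 1, so the largest squared coefficient
    dominates. *)
Lemma U1_ex f : (forall x, nm (f x) <= 1) -> exists xi, U 1 f <= nm (hat f xi) ^+ 2.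
Proof.
move=> f1; exists [arg max_(i > 0) nm (hat f i)]%O.
apply: U1_le => // xi; case: arg_maxP => // i _ /(_ xi isT) le_i.
by rewrite lerXn2r ?nnegrE ?nm_ge0.
Qed.

Lemma U_Es1 t (f : F -> C) : U t.+1 f = Es t (fun h => U 1 (Dls h f)).
Proof.
elim: t f => // t IH f; rewrite -[LHS]/(mean (fun a => U t.+1 (Dl a f))).
apply: eq_mean => a; rewrite IH; apply: eq_Es => h _.
by rewrite Dls_Dl.
Qed.

Fixpoint alt (l : seq (F * F)) (xi : seq F -> F) : F :=
  if l is (a, b) :: l' then alt l' (fun s => xi (a :: s) - xi (b :: s)) else xi [::].

Fixpoint allS (l : seq (F * F)) (S : pred (seq F)) : bool :=
  if l is (a, b) :: l' then allS l' (fun s => S (a :: s) && S (b :: s)) else S [::].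

Lemma altB l xi eta : alt l (fun s => xi s - eta s) = alt l xi - alt l eta.
Proof.
elim: l xi eta => //= -[a b] l IH xi eta; rewrite -!IH; congr alt.
by apply: funext => s; ring.
Qed.

Lemma allS_zip s s' (S : pred (seq F)) : size s = size s' -> allS (zip s s') S -> S s.
Proof.
elim: s s' S => [|a s IH] [|a' s'] S //= [ss]; move/(IH _ _ ss).
by case/andP.
Qed.

(** Subtracting [xi s] removes the only vertex that uses no entry of [s']. Every other vertex has
    some entry of [s] replaced by the fixed one of [s'], hence does not depend on it; the character
    turns the sum into a product. *)
Lemma Low_alt t (xi : seq F -> F) s' : size s' = t ->
  Low t (fun s k => chi ((alt (zip s s') xi - xi s) * k)).
Proof.
elim: t xi s' => [|t IH] xi [|a' s']//=.
  by move=> _ x; rewrite subrr mul0r chi0.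
move=> [st].
exists (fun s k => chi (- alt (zip s s') (fun s => xi (a' :: s)) * k)).
exists (fun a s k => chi ((alt (zip s s') (fun s => xi (a :: s)) - xi (a :: s)) * k)).
split=> [s x|a|a s x]; first by rewrite nm_chi.
  exact: (IH (fun s => xi (a :: s))).
by rewrite altB -chiD; congr chi; ring.
Qed.

(** The frequencies at the vertices combine into their alternating sum, and all that does not
    involve [x] goes into [k]. The cut-off [S] survives only if every vertex satisfies it. *)
Lemma bx_chi l (S : pred (seq F)) (xi : seq F -> F) (c : seq F -> F) :
  exists k : C, [/\ nm k <= 1, ~~ allS l S -> k = 0 & forall x : F,
    bx l (fun s => (S s)%:R * chi (xi s * (x - c s))) = k * chi (alt l xi * x)].
Proof.
exists (bx l (fun s => (S s)%:R * chi (- xi s * c s))); split.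
- apply: bx_le1 => s; apply: nmM_le1; last by rewrite nm_chi.
  by case: (S s); rewrite ?nm1 ?nm0.
- rewrite bxM => nS; suff -> : bx l (fun s => (S s)%:R : C) = 0 by rewrite mul0r.
  elim: l S nS => /= [S /negPf ->//|[a b] l IH S nS].
  apply: etrans (IH _ nS).
  by congr bx; apply: funext => s; case: (S _); case: (S _);
    rewrite /= ?rmorph0 ?rmorph1 ?mulr0 ?mulr1 ?mul0r.
- move=> x; have -> : (fun s => (S s)%:R * chi (xi s * (x - c s))) =
      fun s => (S s)%:R * chi (- xi s * c s) * chi (xi s * x).
    by apply: funext => s; rewrite -mulrA -chiD; congr (_ * chi _); ring.
  rewrite bxM; congr (_ * _).
  elim: l xi {c S} => //= -[a b] l IH xi; rewrite -IH; congr bx.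
  by apply: funext => s; rewrite -chiN -chiD; congr chi; ring.
Qed.

(** With base point [x] minus the sum of [s], the vertices of the cube are [x] minus partial sums of
    [s]. Each vertex other than the base omits some entry of [s], so its factor may go into [b]. *)
Lemma Dls_low t (f : F -> C) : (forall x, nm (f x) <= 1) ->
  exists b : seq F -> F -> C, Low t b /\ forall s x, size s = t ->
    Dls s f (x - \sum_(y <- s) y) = f (x - \sum_(y <- s) y) * b s x.
Proof.
move=> f1; elim: t => [|t [b [bl be]]].
  by exists (fun _ _ => 1); split=> // -[]//= x _; rewrite mulr1.
exists (fun s x => if s is a :: s then
  (Dls s f (x - \sum_(y <- s) y))^* * b s (x - a) else 1); split.
  exists (fun s x => (Dls s f (x - \sum_(y <- s) y))^*), (fun a s x => b s (x - a)).
  split=> // [s x|a]; first by rewrite nm_conj Dls_le1.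
  exact: (Low_comp (fun x => x - a) bl).
move=> [|a s] x //= [st]; rewrite /Dl big_cons opprD !addrA be// -mulrA.
congr (_ * _); rewrite mulrC; congr (_^* * _); congr Dls.
by rewrite addrAC subrK.
Qed.

End Chi.

Lemma mean_ex (R : realFieldType) (T : finType) (f : T -> R) (x0 : T) :
  exists x, mean f <= f x.
Proof.
have T0 : (0 < #|T|)%N by apply/card_gt0P; exists x0.
exists [arg max_(i > x0) f i]%O; apply: mean_le_cst => // x.
by case: arg_maxP => // i _ /(_ x isT).
Qed.

Lemma Es_ex (R : realFieldType) (T : finType) (x0 : T) t (f : seq T -> R) :
  exists2 s, size s = t & Es t f <= f s.
Proof.
elim: t f => [|t IH] f /=; first by exists [::].
have [a fa] := mean_ex (fun a => Es t (fun s => f (a :: s))) x0.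
have [s st fs] := IH (fun s => f (a :: s)).
by exists (a :: s); rewrite /= ?st//; apply: le_trans fa fs.
Qed.

Lemma Es_zip (K : numFieldType) (A : finType) t (f : seq (A * A) -> K) :
  Es t f = Es t (fun s' => Es t (fun s => f (zip s s'))).
Proof.
elim: t f => //= t IH f; rewrite mean_pair mean_exchange; apply: eq_mean => a'.
by rewrite -Es_mean; apply: eq_mean => a; rewrite IH.
Qed.

(* If [f] has a large norm [U t.+1] then, for many [h], the derivative
   [Dls h f] correlates with a character [xi h]. Box Cauchy-Schwarz shows that
   the alternating sums of [xi] often vanish, so that [xi h] is, for many [h],
   a sum of functions each missing one coordinate of [h]; such a twist does not
   affect the norm [U t]. *)
Lemma degree_lowering (R : realType) (p : nat) (chi : 'F_p -> R[i]) t
    (Fd : 'F_p -> 'F_p -> R[i]) (delta tau : R) :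
  is_chi chi -> (forall d x, nm (Fd d x) <= 1) ->
  let f := fun x => mean (fun d => Fd d x) in
  (forall l eta, size l = t -> eta != 0 ->
    nm (mean (fun x => mean (fun d =>
      bx l (fun s => Fd d (x - \sum_(y <- s) y)) * chi (eta * x)))) ^+ 2 <= tau) ->
  0 <= tau -> 0 <= delta -> delta <= U t.+1 f ->
  tau <= (delta / 2) ^+ (2 ^ t) / 2 ->
  (delta / 2 * ((delta / 2) ^+ (2 ^ t) / 2)) ^+ (2 ^ t) <= U t f.
Proof.
move=> chiP Fd1 f small tau0 delta0 le_delta le_tau.
have f1 x : nm (f x) <= 1 by apply: (nm_mean_le1 (Fp_gt0 p)).
have [xi Hxi] := choice (fun h => U1_ex chiP (Dls_le1 h f1)).
pose a h := nm (hat chi (Dls h f) (xi h)) ^+ 2.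
have a0 h : 0 <= a h by apply: sqr_ge0.
pose S h := delta / 2 <= a h.
have lowS : delta / 2 <= Es t (fun h => (S h)%:R * a h).
  suff : delta <= Es t (fun h => (S h)%:R * a h) + delta / 2 by lra.
  rewrite -[X in _ + X](Es_cst (Fp_gt0 p) t) -EsD; apply: le_trans le_delta _.
  rewrite U_Es1; apply: ler_Es => h _; apply: le_trans (Hxi h) _.
  rewrite -/(a h); case: (boolP (S h)) => [_|]; first by rewrite mul1r lerDl; lra.
  by rewrite /S -ltNge mul0r add0r => /ltW.
have [b [bl be]] := Dls_low (p := p) t f1.
pose sg (h : seq 'F_p) : 'F_p := \sum_(y <- h) y.
(* With [f] opened as a mean over [d], the Fourier coefficient is a mean over pairs [(x, d)]; its
   square needs two such pairs, which form the space over which [box_cs] averages. *)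
pose g h (q : 'F_p * 'F_p) : R[i] :=
  Fd q.2 (q.1 - sg h) * ((S h)%:R * chi (xi h * (q.1 - sg h))).
pose Phi h (q : ('F_p * 'F_p) * ('F_p * 'F_p)) := g h q.1 * (g h q.2)^*.
pose B h (q : ('F_p * 'F_p) * ('F_p * 'F_p)) := b h q.1.1 * (b h q.2.1)^*.
have eqS : real_complex R (Es t (fun h => (S h)%:R * a h)) =
    Es t (fun h => mean (fun q => Phi h q * B h q)).
  rewrite rc_Es; apply: eq_Es => h sh.
  transitivity (real_complex R (nm (mean (fun q => g h q * b h q.1)) ^+ 2)).
    apply: (congr1 (real_complex R)).
    have -> : mean (fun q => g h q * b h q.1) = (S h)%:R * hat chi (Dls h f) (xi h).
      rewrite mean_pair /hat -meanMl -[RHS](mean_shift _ (- sg h)).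
      apply: eq_mean => x; rewrite be// /f -!meanMr -meanMl.
      by apply: eq_mean => d; rewrite /g /=; ring.
    by rewrite nmM exprMn /a; case: (S h); rewrite ?nm1 ?nm0 ?expr1n ?expr0n.
  rewrite nm_sqr_mean [RHS]mean_pair; apply: eq_mean => q; apply: eq_mean => q'.
  by rewrite /Phi /B /= conjM mulrACA.
have Bl : Low t B.
  by apply: LowM; [|apply: Low_conj]; apply: (Low_comp _ bl).
have X0 : (0 < #|{: ('F_p * 'F_p) * ('F_p * 'F_p)}|)%N.
  by rewrite !card_prod !muln_gt0 !Fp_gt0.
have FF0 : (0 < #|{: 'F_p * 'F_p}|)%N by rewrite !card_prod !muln_gt0 !Fp_gt0.
pose good (l : seq ('F_p * 'F_p)) := allS l S && (alt l xi == 0).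
have box_le l : size l = t ->
    nm (mean (fun q => bx l (Phi^~ q))) <= (good l)%:R + tau.
  move=> sl.
  have -> : mean (fun q => bx l (Phi^~ q)) =
      real_complex R (nm (mean (fun q => bx l (g^~ q))) ^+ 2).
    rewrite nm_sqr_mean mean_pair; apply: eq_mean => q; apply: eq_mean => q'.
    by rewrite /Phi bxM bx_conj.
  rewrite nm_rc ger0_norm ?sqr_ge0//.
  have [k [k1 k0 ke]] := bx_chi chiP l S xi sg.
  have -> : mean (fun q => bx l (g^~ q)) = k * mean (fun x => mean (fun d =>
      bx l (fun s => Fd d (x - \sum_(y <- s) y)) * chi (alt l xi * x))).
    rewrite mean_pair -meanMl; apply: eq_mean => x.
    rewrite -meanMl; apply: eq_mean => d.
    by rewrite /g bxM /= ke; ring.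
  rewrite nmM exprMn /good; have [lS|/k0->] := boolP (allS l S); last first.
    by rewrite nm0 expr0n mul0r add0r.
  have k2 : nm k ^+ 2 <= 1 by rewrite exprn_ile1 ?nm_ge0.
  (* A nonzero alternating sum is a nontrivial frequency, to which [small] applies; a zero one is
     counted by [good]. *)
  have [al0|aln0] := eqVneq (alt l xi) 0.
    apply: (@le_trans _ _ 1); last by rewrite lerDl.
    rewrite -[leRHS]mulr1 ler_pM ?sqr_ge0// exprn_ile1 ?nm_ge0//.
    apply: (nm_mean_le1 (Fp_gt0 p)) => x; apply: (nm_mean_le1 (Fp_gt0 p)) => d.
    by apply: nmM_le1; [apply: bx_le1|rewrite nm_chi].
  rewrite add0r -[leRHS]mul1r ler_pM ?sqr_ge0//.
  exact: small.
have le_good : (delta / 2) ^+ (2 ^ t) / 2 <= Es t (fun l => (good l)%:R).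
  suff : (delta / 2) ^+ (2 ^ t) <= Es t (fun l => (good l)%:R) + tau by lra.
  rewrite -[X in _ + X](Es_cst FF0 t) -EsD.
  apply: le_trans (ler_Es box_le); apply: le_trans (box_cs _ (Fp_gt0 p) X0 Bl).
  rewrite -eqS nm_rc ger0_norm; last by apply: Es_ge0 => h; rewrite mulr_ge0.
  by rewrite lerXn2r ?nnegrE//; lra.
rewrite Es_zip in le_good.
(* Freeze the second ends of the boxes. For every [s] that is still good the alternating sum
   vanishes, so [xi s] equals [- psi s], and [psi] has the structure required by [twisted_U]. *)
have [s' ss' le_s'] := Es_ex (0 : 'F_p) t
  (fun s' => Es t (fun s => (good (zip s s'))%:R : R)).
pose psi s := alt (zip s s') xi - xi s.
have := twisted_U f1 (Low_alt chiP xi ss').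
apply: le_trans; rewrite lerXn2r ?nnegrE ?nm_ge0//.
  rewrite mulr_ge0 ?divr_ge0 ?exprn_ge0//; lra.
have -> : Es t (fun s => mean (fun k =>
      mean (Dls s (Dl k f)) * chi ((alt (zip s s') xi - xi s) * k))) =
    real_complex R (Es t (fun s => nm (hat chi (Dls s f) (- psi s)) ^+ 2)).
  rewrite rc_Es; apply: eq_Es => s _; rewrite (hat_sqr chiP).
  by apply: eq_mean => k; rewrite -(chiN chiP) -Dls_Dl -mulNr opprK.
rewrite nm_rc ger0_norm; last by apply: Es_ge0 => s; apply: sqr_ge0.
apply: (@le_trans _ _ (delta / 2 * Es t (fun s => (good (zip s s'))%:R))).
  by rewrite ler_wpM2l ?(le_trans le_good le_s')//; lra.
rewrite -EsMl; apply: ler_Es => s ss.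
have [|_] := boolP (good _); last by rewrite mulr0 sqr_ge0.
case/andP => /(allS_zip (etrans ss (esym ss'))) Ss /eqP al0.
by rewrite mulr1 /psi al0 sub0r opprK.
Qed.

(** * Polynomial shifts and Weyl sums *)

Lemma mean_eq1 (K : numFieldType) (T : finType) (a : T) :
  mean (fun x => (x == a)%:R) = #|T|%:R^-1 :> K.
Proof. by rewrite /mean (bigD1 a)//= eqxx big1 ?addr0 ?mulr1// => x /negPf->. Qed.

Definition shp (K : nzRingType) (h : K) (Q : {poly K}) : {poly K} := Q \Po ('X + h%:P).

Section Shp.
Variable K : fieldType.
Implicit Types (h : K) (Q : {poly K}).

Lemma horner_shp h Q d : (shp h Q).[d] = Q.[d + h].
Proof. by rewrite horner_comp !hornerE. Qed.

Lemma size_shp h Q : size (shp h Q) = size Q.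
Proof. by rewrite size_comp_poly2// size_XaddC. Qed.

Lemma lead_shp h Q : lead_coef (shp h Q) = lead_coef Q.
Proof. by rewrite lead_coef_comp ?size_XaddC// lead_coefXaddC expr1n mulr1. Qed.

Lemma shpB h Q Q' : shp h (Q - Q') = shp h Q - shp h Q'.
Proof. by rewrite /shp rmorphB. Qed.

Lemma shpD h h' Q : shp h (shp h' Q) = shp (h + h') Q.
Proof.
rewrite /shp -comp_polyA comp_polyD comp_polyX comp_polyC -addrA.
by rewrite -polyCD.
Qed.

Lemma coef_shp_lead h Q m : (size Q <= m.+1)%N -> (shp h Q)`_m = Q`_m.
Proof.
rewrite leq_eqVlt => /predU1P[sQ|]; last first.
  by move=> sQ; rewrite !nth_default// size_shp.
have := lead_shp h Q; rewrite !lead_coefE size_shp sQ.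
by [].
Qed.

Lemma size_shpB h Q m : (size Q <= m.+1)%N -> (size (shp h Q - Q)%R <= m)%N.
Proof.
move=> sQ; apply/leq_sizeP => j mj; rewrite coefB.
by rewrite coef_shp_lead ?subrr// (leq_trans sQ).
Qed.

End Shp.

Lemma Fp_natr_neq0 p n : prime p -> (0 < n < p)%N -> n%:R != 0 :> 'F_p.
Proof.
move=> pp /andP[n0 np]; rewrite -(dvdn_pcharf (pchar_Fp pp)).
by rewrite gtnNdvd.
Qed.

(** For [Q] of degree [n.+1 < p], the coefficient of the difference at [n] is [n.+1 * h] times the
    leading coefficient of [Q], hence nonzero modulo [p]. *)
Lemma size_shp_diff p (h : 'F_p) (Q : {poly 'F_p}) : prime p ->
  (1 < size Q <= p)%N -> h != 0 -> size (shp h Q - Q) = (size Q).-1.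
Proof.
move=> pp /andP[]; case sQ: (size Q) => [|[|n]]// _ np h0 /=.
apply/eqP; rewrite eqn_leq size_shpB ?sQ//= ltnNge; apply: contraTN isT.
move=> /leq_sizeP /(_ n (leqnn n)).
pose Q0 := Q - Q`_n.+1 *: 'X^(n.+1).
have sQ0 : (size Q0 <= n.+1)%N.
  apply/leq_sizeP => j; rewrite leq_eqVlt => /predU1P[<-|nj].
    by rewrite !coefE eqxx mulr1 subrr.
  by rewrite !coefE gtn_eqF// mulr0 subr0 nth_default ?sQ.
have -> : shp h Q - Q = (shp h Q0 - Q0) +
    Q`_n.+1 *: (h%:P * \sum_(i < n.+1) ('X + h%:P) ^+ (n - i) * 'X^i).
  have -> : h%:P * \sum_(i < n.+1) ('X + h%:P) ^+ (n - i) * 'X^i =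
      ('X + h%:P) ^+ n.+1 - 'X^(n.+1).
    by rewrite subrXX addrAC subrr add0r; congr (_ * _); apply: eq_bigr => i _; rewrite subSS.
  rewrite /Q0 shpB /shp comp_polyZ comp_Xn_poly -!mul_polyC; ring.
rewrite coefD coefB coef_shp_lead// subrr add0r coefZ coefCM coef_sum.
rewrite (eq_bigr (fun _ => 1)) => [|i _]; last first.
  have im : ('X + h%:P) ^+ (n - i) * 'X^i \is monic.
    by rewrite monicMl ?monicXn// monic_exp// monicXaddC.
  have sz : size (('X + h%:P) ^+ (n - i) * 'X^i : {poly 'F_p}) = n.+1.
    rewrite size_monicM ?monic_neq0 ?monicXn ?monic_exp ?monicXaddC//.
    rewrite size_polyXn -[h]opprK polyCN size_exp_XsubC.
    by rewrite addnS /= addSn subnK// -ltnS.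
  by move: im => /monicP; rewrite lead_coefE sz.
rewrite sumr_const card_ord => /eqP; rewrite !mulf_eq0 (negPf h0).
rewrite (negPf (Fp_natr_neq0 pp _)) ?orbF; last by [].
have -> : Q`_n.+1 = lead_coef Q by rewrite lead_coefE sQ.
by rewrite lead_coef_eq0 -size_poly_eq0 sQ.
Qed.

(** Weyl differencing down to degree one, where the complete sum of a nontrivial character vanishes.
    Each squaring pays [1 / p] for the shift [h = 0], whence [n / p]. *)
Lemma weyl (R : realType) p (chi : 'F_p -> R[i]) n (Q : {poly 'F_p}) :
  prime p -> is_chi chi -> size Q = n.+2 -> (n.+2 <= p)%N ->
  nm (mean (fun d => chi Q.[d])) ^+ (2 ^ n) <= n%:R / p%:R.
Proof.
move=> pp chiP; elim: n Q => [|n IH] Q sQ np.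
  rewrite expr1 mul0r.
  under eq_mean do rewrite horner_coef sQ 2!big_ord_recl big_ord0 /= addr0 (chiD chiP).
  under eq_mean do rewrite expr0 expr1.
  rewrite meanMl (mean_chi chiP).
  have -> : Q`_1 = lead_coef Q by rewrite lead_coefE sQ.
  by rewrite lead_coef_eq0 -size_poly_eq0 sQ mulr0 nm0.
pose G h := mean (fun d => chi (shp h Q - Q).[d]).
have GE : real_complex R (nm (mean (fun d => chi Q.[d])) ^+ 2) = mean G.
  rewrite nm_sqr_mean mean_exchange [RHS]mean_exchange; apply: eq_mean => d.
  rewrite -[LHS](mean_shiftl _ d); apply: eq_mean => h.
  by rewrite hornerD hornerN horner_shp (chiD chiP) (chiN chiP).
have le2 : nm (mean (fun d => chi Q.[d])) ^+ 2 <= mean (fun h => nm (G h)).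
  by rewrite -[leLHS]ger0_norm ?sqr_ge0// -nm_rc GE nm_mean.
rewrite expnS exprM.
apply: le_trans (_ : mean (fun h => nm (G h)) ^+ (2 ^ n) <= _).
  rewrite lerXn2r ?nnegrE ?sqr_ge0//.
  by apply: mean_ge0 => h; apply: nm_ge0.
apply: le_trans (mean_pow _ (Fp_gt0 p) _) _; first by move=> h; apply: nm_ge0.
apply: (@le_trans _ _ (mean (fun h : 'F_p => (h == 0)%:R + n%:R / p%:R))).
  apply: ler_mean => h; have [->|h0] := eqVneq h 0.
    apply: (@le_trans _ _ 1); last by rewrite lerDl divr_ge0 ?ler0n.
    rewrite exprn_ile1 ?nm_ge0// (nm_mean_le1 (Fp_gt0 p))// => d.
    by rewrite (nm_chi chiP).
  rewrite add0r; apply: IH; last exact: ltnW.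
  by rewrite size_shp_diff// sQ.
by rewrite meanD mean_eq1 (mean_cst (Fp_gt0 p)) card_Fp// -natr1 mulrDl addrC mul1r.
Qed.

(** * PET induction *)

(* The differences of distinct members of a family are all nonconstant iff the
   family is duplicate-free after applying [nc]. *)
Definition nc (K : nzRingType) (Q : {poly K}) : {poly K} := Q - (Q`_0)%:P.

Lemma nc_eq (K : nzRingType) (Q Q' : {poly K}) :
  (nc Q == nc Q') = (size (Q - Q')%R <= 1)%N.
Proof.
apply/eqP/idP => [QQ'|/size1_polyC QQ'].
  have -> : Q - Q' = (Q`_0)%:P - (Q'`_0)%:P.
    rewrite -{1}[Q](subrK (Q`_0)%:P) -{1}[Q'](subrK (Q'`_0)%:P).
    by rewrite -/(nc Q) -/(nc Q') QQ' opprD addrACA subrr add0r.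
  by rewrite -polyCB size_polyC leq_b1.
apply/eqP; rewrite -subr_eq0 /nc opprD addrACA QQ' coefB polyCB opprK.
by rewrite addrACA subrr addNr addr0.
Qed.

(* The index [e] stands for degree [e.+1], that is, size [e.+2]. *)
Definition wt (K : fieldType) (e : nat) (ls : seq {poly K}) : nat :=
  size (undup [seq lead_coef Q | Q : {poly K} <- ls & size Q == e.+2]).

Definition vdp (K : fieldType) (h : K) (ls : seq {poly K}) : seq {poly K} :=
  flatten [seq (if (size Q <= 2)%N then [:: Q] else [:: Q; shp h Q]) | Q : {poly K} <- ls].

Lemma seq_argmax (T : eqType) (f : T -> nat) (s : seq T) : s != [::] ->
  exists2 x, x \in s & forall y, y \in s -> (f y <= f x)%N.
Proof.
elim: s => // a [|b s] IH _.
  by exists a; rewrite ?mem_head// => y; rewrite inE => /eqP->.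
have [x xs xmax] := IH isT; have [ax|xa] := leqP (f a) (f x).
  exists x; first by rewrite inE xs orbT.
  by move=> y; rewrite inE => /predU1P[->//|/xmax].
exists a; first by rewrite mem_head.
move=> y; rewrite inE => /predU1P[->//|/xmax yx].
exact: leq_trans yx (ltnW xa).
Qed.

Lemma seq_argmin (T : eqType) (f : T -> nat) (s : seq T) : s != [::] ->
  exists2 x, x \in s & forall y, y \in s -> (f x <= f y)%N.
Proof.
elim: s => // a [|b s] IH _.
  by exists a; rewrite ?mem_head// => y; rewrite inE => /eqP->.
have [x xs xmin] := IH isT; have [ax|xa] := leqP (f x) (f a).
  exists x; first by rewrite inE xs orbT.
  by move=> y; rewrite inE => /predU1P[->//|/xmin].
exists a; first by rewrite mem_head.
move=> y; rewrite inE => /predU1P[->//|/xmin yx].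
exact: leq_trans (ltnW xa) yx.
Qed.

Section PolyFamily.
Variable K : fieldType.
Implicit Types (Q B : {poly K}) (ls : seq {poly K}).

Lemma wt_gt0 Q ls e : Q \in ls -> size Q = e.+2 -> (0 < wt e ls)%N.
Proof.
move=> Qls sQ; rewrite /wt.
have : lead_coef Q \in undup [seq lead_coef Q | Q : {poly K} <- ls & size Q == e.+2].
  by rewrite mem_undup map_f// mem_filter sQ eqxx.
by case: undup.
Qed.

Lemma wt_sub ls ls' e :
  (forall Q, Q \in ls -> size Q = e.+2 -> exists2 Q', Q' \in ls' &
     size Q' = e.+2 /\ lead_coef Q' = lead_coef Q) ->
  (wt e ls <= wt e ls')%N.
Proof.
move=> sub; apply: uniq_leq_size; first exact: undup_uniq.
move=> c; rewrite !mem_undup => /mapP[Q]; rewrite mem_filter.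
move=> /andP[/eqP sQ /sub /(_ sQ)[Q' Q'ls' [sQ' lQ']]] ->.
by rewrite -lQ' map_f// mem_filter sQ' eqxx.
Qed.

(** After subtracting a base point with leading coefficient [b], the leading coefficients that
    remain are among the [c - b] with [c] different from [b], so one class is lost. *)
Lemma wt_lt ls ls' e b :
  (exists2 Q, Q \in ls' & size Q = e.+2 /\ lead_coef Q = b) ->
  (forall Q, Q \in ls -> size Q = e.+2 -> exists2 Q', Q' \in ls' &
     [/\ size Q' = e.+2, lead_coef Q' != b & lead_coef Q = lead_coef Q' - b]) ->
  (wt e ls < wt e ls')%N.
Proof.
move=> [B Bls' [sB lB]] sub; set u := undup [seq lead_coef Q | Q : {poly K} <- ls' & size Q == e.+2].
have bu : b \in u.
  by rewrite mem_undup -lB map_f// mem_filter sB eqxx.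
have -> : wt e ls' = (size [seq c - b | c <- rem b u]).+1.
  by rewrite size_map size_rem// prednK// /wt -/u; case: u bu.
rewrite ltnS; apply: uniq_leq_size; first exact: undup_uniq.
move=> c; rewrite !mem_undup => /mapP[Q]; rewrite mem_filter.
move=> /andP[/eqP sQ /sub /(_ sQ)[Q' Q'ls' [sQ' lQ' ->]]] ->.
apply: map_f; rewrite mem_rem_uniq ?undup_uniq// inE lQ'/=.
by rewrite mem_undup map_f// mem_filter sQ' eqxx.
Qed.

Lemma mem_vdp h ls Q : Q \in vdp h ls ->
  exists2 Q', Q' \in ls & (Q = Q' \/ (2 < size Q')%N /\ Q = shp h Q').
Proof.
move=> /flattenP[_ /mapP[Q' Q'ls ->]]; case: ifP => s2; rewrite !inE.
  by move=> /eqP->; exists Q' => //; left.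
move=> /orP[/eqP->|/eqP->]; exists Q' => //; [by left|right].
by rewrite ltnNge s2.
Qed.

Lemma mem_vdp_lead h ls Q : Q \in vdp h ls ->
  exists2 Q', Q' \in ls & size Q' = size Q /\ lead_coef Q' = lead_coef Q.
Proof.
move=> /mem_vdp[Q' Q'ls [->|[_ ->]]]; exists Q' => //.
by rewrite size_shp lead_shp.
Qed.

Lemma vdp_sub h ls Q : Q \in ls -> Q \in vdp h ls.
Proof.
move=> Qls; apply/flattenP; exists (if (size Q <= 2)%N then [:: Q] else [:: Q; shp h Q]).
  by apply/mapP; exists Q.
by case: ifP => _; rewrite mem_head.
Qed.

Lemma size_subr_class Q B : (size B <= size Q)%N ->
  (size Q != size B) || (lead_coef Q != lead_coef B) ->
  size (Q - B) = size Q /\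
  lead_coef (Q - B) = if size Q == size B then lead_coef Q - lead_coef B
                      else lead_coef Q.
Proof.
rewrite leq_eqVlt => /predU1P[sBQ|sBQ].
  rewrite sBQ eqxx /= => lQB.
  have c : (Q - B)`_(size Q).-1 = lead_coef Q - lead_coef B.
    by rewrite coefB !lead_coefE sBQ.
  have s : size (Q - B) = size Q.
    apply/eqP; rewrite eqn_leq; apply/andP; split.
      by rewrite (leq_trans (size_polyD _ _))// size_polyN sBQ maxnn.
    rewrite -[leqLHS]prednK; last first.
      by rewrite lt0n size_poly_eq0; apply: contra_neq lQB => Q0; apply/eqP;
         rewrite Q0 lead_coef0 eq_sym lead_coef_eq0 -size_poly_eq0 sBQ Q0 size_poly0.
    rewrite ltnNge; apply: contra_neqN lQB => /leq_sizeP /(_ _ (leqnn _)).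
    by rewrite c => /eqP; rewrite subr_eq0 => /eqP.
  by split=> //; rewrite lead_coefE s c.
move=> _; rewrite gtn_eqF//; split.
  by rewrite size_polyDl// size_polyN.
by rewrite lead_coefDl// size_polyN.
Qed.

Lemma size_subr_lt Q B : (0 < size Q)%N -> size B = size Q -> lead_coef B = lead_coef Q ->
  (size (Q - B)%R < size Q)%N.
Proof.
move=> Q0 sB lB; rewrite -[ltnRHS]prednK// ltnS; apply/leq_sizeP => j.
rewrite leq_eqVlt => /predU1P[<-|].
  by rewrite coefB; move: lB; rewrite !lead_coefE sB => ->; rewrite subrr.
rewrite -ltnS prednK// ltnS => sj.
by rewrite coefB !nth_default ?subrr ?sB.
Qed.

(* [B] becomes the new base point: it has minimal size among the polynomials
   outside the class of [Q1], or, if there are none, maximizes the size of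
   [Q1 - B]. *)
Lemma vdp_base D h Q1 l :
  (forall Q, Q \in Q1 :: l -> (1 < size Q <= size Q1)%N) -> (size Q1 <= D.+1)%N ->
  (l != [::]) || (2 < size Q1)%N ->
  exists2 B, B \in behead (vdp h (Q1 :: l)) & exists2 e, (e < D)%N &
    [/\ (0 < wt e (Q1 :: l))%N,
        (forall Q, Q \in vdp h (Q1 :: l) -> (size (Q - B)%R <= size (Q1 - B)%R)%N),
        (size (Q1 - B)%R <= size Q1)%N,
        (wt e [seq (Q - B)%R | Q <- vdp h (Q1 :: l)] < wt e (Q1 :: l))%N &
        forall e', (e < e')%N ->
          (wt e' [seq (Q - B)%R | Q <- vdp h (Q1 :: l)] <= wt e' (Q1 :: l))%N].
Proof.
move=> sl sQ1 nbase.
have sub_tail Q : Q \in l -> Q \in behead (vdp h (Q1 :: l)).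
  by move=> Ql; rewrite /vdp /=; case: ifP => _ /=;
     rewrite ?inE (vdp_sub h Ql : Q \in flatten _) ?orbT.
have vdpE : vdp h (Q1 :: l) = Q1 :: behead (vdp h (Q1 :: l)).
  by rewrite /vdp /=; case: ifP.
have s1 : (1 < size Q1)%N by have /andP[] := sl Q1 (mem_head _ _).
pose other Q := (size Q1 != size Q) || (lead_coef Q1 != lead_coef Q).
have [|noother] := boolP (has other l).
  rewrite has_filter => /(seq_argmin (fun Q => size Q))[B].
  rewrite mem_filter => /andP[oB Bl] Bmin0.
  have Bls : B \in Q1 :: l by rewrite inE Bl orbT.
  have /andP[sB sBQ1] := sl _ Bls.
  (* Members of the class of [Q1] have maximal size, so [B] is minimal in the whole family. *)
  have Bmin Q : Q \in Q1 :: l -> (size B <= size Q)%N.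
    rewrite inE => /predU1P[->//|Ql].
    have [oQ|] := boolP (other Q); first by apply: Bmin0; rewrite mem_filter oQ.
    by rewrite /other negb_or !negbK => /andP[/eqP<-].
  have [eB seB] : exists e, size B = e.+2 by exists (size B).-2; case: (size B) sB => [|[]].
  have Bvd Q : Q \in vdp h (Q1 :: l) -> (size B <= size Q <= size Q1)%N.
    move=> /mem_vdp_lead[Q' Q'ls [<- _]]; rewrite Bmin//.
    by have /andP[] := sl _ Q'ls.
  have [s1B _] := size_subr_class sBQ1 oB.
  exists B; first exact: sub_tail.
  exists eB; first by rewrite -ltnS -seB (leq_trans sBQ1).
  split.
  - exact: wt_gt0 Bls seB.
  - move=> Q /Bvd /andP[BQ QQ1]; rewrite s1B (leq_trans (size_polyD _ _))//.
    by rewrite size_polyN geq_max QQ1.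
  - by rewrite s1B.
  - apply: (@wt_lt _ _ _ (lead_coef B)); first by exists B.
    move=> _ /mapP[Q Qvd ->] sQB; have /andP[BQ _] := Bvd _ Qvd.
    have [Q' Q'ls [sQ' lQ']] := mem_vdp_lead Qvd.
    have [cl|] := boolP ((size Q != size B) || (lead_coef Q != lead_coef B)).
      have [sz ld] := size_subr_class BQ cl.
      have sQ : size Q = size B by rewrite -sz sQB seB.
      move: ld cl; rewrite sQ eqxx /= => ld cl.
      by exists Q' => //; rewrite sQ' lQ' sQ seB.
    rewrite negb_or !negbK => /andP[/eqP sQ /eqP lQ].
    have := @size_subr_lt Q B; rewrite sQB sQ seB => /(_ isT erefl (esym lQ)).
    by rewrite ltnn.
  - move=> e' ee'; apply: wt_sub => _ /mapP[Q Qvd ->] sQB.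
    have /andP[BQ _] := Bvd _ Qvd.
    have [Q' Q'ls [sQ' lQ']] := mem_vdp_lead Qvd.
    have sBQ : (size B < size Q)%N.
      rewrite ltn_neqAle BQ andbT; apply: contraTneq ee' => sBQ.
      rewrite -leqNgt -2!ltnS -seB -sQB (leq_trans (size_polyD _ _))//.
      by rewrite size_polyN sBQ maxnn.
    have := @size_subr_class Q B BQ; rewrite neq_ltn sBQ orbT => /(_ isT) [sz].
    rewrite gtn_eqF// => ld.
    by exists Q' => //; rewrite sQ' lQ' -sz.
(* All members now share the class of [Q1], so every difference drops below the size of [Q1] and the
   weight at the top index becomes zero. *)
have same Q : Q \in vdp h (Q1 :: l) -> size Q = size Q1 /\ lead_coef Q = lead_coef Q1.
  move=> /mem_vdp_lead[Q' Q'ls [<- <-]]; move: Q'ls.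
  rewrite inE => /predU1P[->//|Q'l].
  have /hasPn/(_ Q' Q'l) := noother.
  by rewrite /other negb_or !negbK => /andP[/eqP<- /eqP<-].
have rest0 : behead (vdp h (Q1 :: l)) != [::].
  have [l0|ln0] := eqVneq l [::].
    by move: nbase; rewrite l0 eqxx /= /vdp /= => s2; rewrite leqNgt s2.
  by case: l sub_tail ln0 {sl nbase vdpE noother same} => // a l /(_ a (mem_head _ _));
     case: behead.
have [B Brest Bmax] := seq_argmax (fun B => size (Q1 - B)) rest0.
have Bvd : B \in vdp h (Q1 :: l) by rewrite vdpE inE Brest orbT.
have lt1 Q : Q \in vdp h (Q1 :: l) -> (size (Q - B)%R < size Q1)%N.
  move=> Qvd; have [sQ lQ] := same _ Qvd; have [sB lB] := same _ Bvd.
  by rewrite -sQ size_subr_lt ?sQ ?sB ?lQ ?lB// ltnW.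
have Q1vd : Q1 \in vdp h (Q1 :: l) by apply: vdp_sub; rewrite mem_head.
have [e se] : exists e, size Q1 = e.+2 by exists (size Q1).-2; case: (size Q1) s1 => [|[]].
have wt0 e' : (e <= e')%N -> wt e' [seq (Q - B)%R | Q <- vdp h (Q1 :: l)] = 0%N.
  move=> ee'; rewrite /wt; case E: filter => [//|Q t].
  have : Q \in Q :: t by rewrite mem_head.
  rewrite -E mem_filter => /andP[/eqP sQ /mapP[Q' Q'vd QE]].
  by have := lt1 _ Q'vd; rewrite -QE sQ se !ltnS ltnNge ee'.
exists B => //; exists e; first by rewrite -ltnS -se.
split.
- by apply: wt_gt0 se; rewrite mem_head.
- move=> Q; rewrite vdpE inE => /predU1P[->//|Qrest].
  have -> : Q - B = (Q1 - B) - (Q1 - Q) by ring.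
  by rewrite (leq_trans (size_polyD _ _))// size_polyN geq_max leqnn Bmax.
- exact/ltnW/lt1.
- by rewrite wt0//; apply: wt_gt0 se; rewrite mem_head.
- by move=> e' ee'; rewrite wt0// ltnW.
Qed.

Lemma nc_shp h Q Q' : (nc (shp h Q) == nc (shp h Q')) = (nc Q == nc Q').
Proof. by rewrite !nc_eq -shpB size_shp. Qed.

Lemma uniq_vdp h ls : uniq (map (@nc K) ls) ->
  {in ls &, forall Q Q', (2 < size Q)%N -> nc (shp h Q) != nc Q'} ->
  uniq (map (@nc K) (vdp h ls)).
Proof.
elim: ls => //= Q l IH /andP[nQ ul] good.
have goodl : {in l &, forall Q Q', (2 < size Q)%N -> nc (shp h Q) != nc Q'}.
  by move=> A B Al Bl; apply: good; rewrite inE ?Al ?Bl orbT.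
have nQ' A : A \in l -> nc Q != nc A.
  by move=> Al; apply: contraNneq nQ => ->; apply: map_f.
have n1 : nc Q \notin [seq nc Q | Q <- vdp h l].
  apply/mapP => -[A /mem_vdp[A' A'l [->|[s2 ->]]]] /eqP.
    by apply/negP; apply: nQ'.
  by rewrite eq_sym; apply/negP; apply: good; rewrite ?inE ?A'l ?eqxx ?orbT.
rewrite /vdp /= -/(vdp h l); case: ifP => s2 /=; rewrite ?n1 IH// !andbT.
have {}s2 : (2 < size Q)%N by rewrite ltnNge s2.
rewrite inE negb_or n1 andbT eq_sym good ?mem_head//=.
apply/mapP => -[A /mem_vdp[A' A'l [->|[_ ->]]]] /eqP; apply/negP.
  by apply: good; rewrite ?inE ?A'l ?eqxx ?orbT.
by rewrite nc_shp; apply: nQ'.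
Qed.

End PolyFamily.

(** For a given pair at most one [h] makes the shift of [Q] equivalent to [Q']: two such shifts
    would differ by a constant, whereas their difference has size [(size Q).-1], at least 2. The
    numerator counts the pairs. *)
Lemma mean_bad (R : realType) p (ls : seq {poly 'F_p}) : prime p ->
  (forall Q, Q \in ls -> (size Q <= p)%N) -> uniq (map (@nc _) ls) ->
  mean (fun h : 'F_p => (~~ uniq (map (@nc _) (vdp h ls)))%:R) <=
    (size ls ^ 2)%:R / p%:R :> R.
Proof.
move=> pp sp ul.
pose b (h : 'F_p) (Q Q' : {poly 'F_p}) : bool := (2 < size Q)%N && (nc (shp h Q) == nc Q').
have b1 Q Q' : Q \in ls -> mean (fun h => (b h Q Q')%:R) <= p%:R^-1 :> R.
  move=> Qls; have [h0 b0|nb] := pickP (fun h => b h Q Q'); last first.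
    under eq_mean do rewrite nb.
    by rewrite (mean_cst (Fp_gt0 p)) invr_ge0.
  rewrite -[X in X%:R^-1](card_Fp pp) -(mean_eq1 R h0); apply: ler_mean => h.
  case: (boolP (b h Q Q')) => // bh; have [//|hh0] := eqVneq h h0.
  move: b0 bh; rewrite /b => /andP[s2 /eqP <-] /andP[_].
  rewrite nc_eq -[shp h Q](_ : shp h0 (shp (h - h0) Q) = _); last first.
    by rewrite shpD addrC subrK.
  rewrite -shpB size_shp size_shp_diff ?subr_eq0//; last first.
    by rewrite (ltn_trans _ s2)// sp.
  by case: (size Q) s2 => [|[|[]]].
apply: (@le_trans _ _ (mean (fun h => \sum_(Q <- ls) \sum_(Q' <- ls) (b h Q Q')%:R))).
  apply: ler_mean => h; case: (boolP (uniq _)) => [_|nu] /=.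
    by rewrite sumr_ge0// => Q _; rewrite sumr_ge0.
  have [Q Qls [Q' Q'ls bQ]] : exists2 Q, Q \in ls & exists2 Q', Q' \in ls & b h Q Q'.
    have [/hasP[Q Qls /hasP[Q' Q'ls bQ]]|nb] := boolP (has (fun Q => has (b h Q) ls) ls).
      by exists Q => //; exists Q'.
    case/negP: nu; apply: uniq_vdp => // Q Q' Qls Q'ls s2.
    by have /hasPn/(_ Q Qls)/hasPn/(_ Q' Q'ls) := nb; rewrite /b s2.
  rewrite (big_rem Q Qls) (big_rem Q' Q'ls) bQ /= -addrA lerDl addr_ge0 ?sumr_ge0//.
  by move=> A _; rewrite sumr_ge0.
rewrite mean_sum; under eq_bigr do rewrite mean_sum.
rewrite (@le_trans _ _ (\sum_(Q <- ls) \sum_(Q' <- ls) p%:R^-1))//.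
  by rewrite big_seq [leRHS]big_seq; apply: ler_sum => Q Qls; apply: ler_sum => Q' _; apply: b1.
under eq_bigr do rewrite big_const_seq count_predT iter_addr_0.
by rewrite big_const_seq count_predT iter_addr_0 -mulrnA mulnn mulr_natl.
Qed.

(** * The van der Corput step *)

Section Lam.
Variables (R : realType) (p : nat).
Local Notation C := R[i].
Local Notation F := 'F_p.
Local Notation pf := ({poly F} * {ffun F -> C})%type.
Implicit Types (L : seq pf).

(** Finite functions make the members of [L] comparable, so that [\in], [rem] and [perm_eq] are
    available. *)
Definition Lam L : C :=
  mean (fun x => mean (fun d => \prod_(q <- L) q.2 (x + q.1.[d]))).

Definition bdd L : Prop := forall q, q \in L -> forall x, nm (q.2 x) <= 1.

Lemma Lam_perm L L' : perm_eq L L' -> Lam L = Lam L'.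
Proof.
by move=> LL'; apply: eq_mean => x; apply: eq_mean => d; apply: perm_big.
Qed.

Lemma Lam_shift B L : Lam [seq (q.1 - B, q.2) | q <- L] = Lam L.
Proof.
rewrite /Lam mean_exchange [RHS]mean_exchange; apply: eq_mean => d.
rewrite -[RHS](mean_shift _ (- B.[d])); apply: eq_mean => x.
rewrite big_map; apply: eq_bigr => q _ /=.
by rewrite hornerD hornerN -addrA [- _ + _]addrC.
Qed.

Lemma Lam_le1 L : bdd L -> nm (Lam L) <= 1.
Proof.
move=> bL; apply: (nm_mean_le1 (Fp_gt0 p)) => x; apply: (nm_mean_le1 (Fp_gt0 p)) => d.
by rewrite big_seq; apply: nm_prod_le1 => q qL; apply: bL.
Qed.

(* If [q.1] is linear then [q.1 (d + h) - q.1 d] is constant, and the two shifted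
   copies of [q.2] merge into one function. *)
Definition vd1 (h : F) (q : pf) : seq pf :=
  if (size q.1 <= 2)%N then [:: (q.1, [ffun x => Dl (lead_coef q.1 * h) q.2 x])]
  else [:: q; (shp h q.1, [ffun x => (q.2 x)^*])].

Definition vd h L : seq pf := flatten [seq vd1 h q | q <- L].

Lemma vd_vdp h L : [seq q.1 | q <- vd h L] = vdp h [seq q.1 | q <- L].
Proof.
rewrite /vd /vdp map_flatten -!map_comp; congr flatten; apply: eq_map => -[Q f] /=.
by rewrite /vd1 /=; case: ifP.
Qed.

Lemma bdd_vd h L : bdd L -> bdd (vd h L).
Proof.
move=> bL q /flattenP[_ /mapP[r rL ->]]; rewrite /vd1; case: ifP => _; rewrite !inE.
  by move=> /eqP-> x /=; rewrite ffunE Dl_le1//; apply: bL.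
by case/orP => /eqP-> x /=; rewrite ?ffunE ?nm_conj; apply: bL.
Qed.

Lemma size_vd h L : (size (vd h L) <= 2 * size L)%N.
Proof.
elim: L => // q L IH; rewrite /vd /= size_cat mulnS leq_add//.
by rewrite /vd1; case: ifP.
Qed.

(** Cauchy-Schwarz in [x] drops [f0], whose polynomial is zero and which therefore ignores [d]; the
    square pairs [d] with [d + h]. *)
Lemma Lam_vdc (f0 : {ffun F -> C}) L : (forall x, nm (f0 x) <= 1) ->
  (forall q, q \in L -> (1 < size q.1)%N) ->
  nm (Lam ((0, f0) :: L)) ^+ 2 <= mean (fun h => nm (Lam (vd h L))).
Proof.
move=> f01 sL; pose G x d := \prod_(q <- L) q.2 (x + q.1.[d]).
have -> : Lam ((0, f0) :: L) = mean (fun x => f0 x * mean (G x)).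
  apply: eq_mean => x; rewrite -meanMl; apply: eq_mean => d.
  by rewrite big_cons /= horner0 addr0.
apply: le_trans (nm_mean_sqr (fun x => mean (G x)) (Fp_gt0 p) f01) _.
have v0 : 0 <= mean (fun x => nm (mean (G x)) ^+ 2).
  by apply: mean_ge0 => x; apply: sqr_ge0.
rewrite -[leLHS]ger0_norm// -nm_rc; apply: le_trans (nm_mean _).
suff -> : real_complex R (mean (fun x => nm (mean (G x)) ^+ 2)) =
  mean (fun h => Lam (vd h L)) by [].
rewrite rc_mean mean_exchange; apply: eq_mean => x; rewrite nm_sqr_mean.
rewrite [RHS]mean_exchange; apply: eq_mean => d.
rewrite -[LHS](mean_shiftl _ d); apply: eq_mean => h.
rewrite /G rmorph_prod -big_split /= /vd big_flatten big_map.
apply: eq_big_seq => q qL.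
rewrite /vd1; case: ifP => s2; last by rewrite big_cons big_seq1 /= ffunE horner_shp.
have sq : size q.1 = 2%N by apply/eqP; rewrite eqn_leq s2 sL.
have -> : x + q.1.[d + h] = x + q.1.[d] + lead_coef q.1 * h.
  rewrite lead_coefE sq /= !horner_coef sq !big_ord_recl !big_ord0 /=.
  by rewrite !expr0 !expr1; ring.
by rewrite big_seq1 /= ffunE.
Qed.

Lemma ffun_funE (g : F -> C) : [ffun x => g x] = g :> (F -> C).
Proof. by apply: funext => x; rewrite ffunE. Qed.

End Lam.

(** * Common parameters and lexicographic induction *)

Lemma bound_raise1 (R : realFieldType) (N N' : nat) (a u u' iota : R) :
  0 <= a <= 1 -> 0 <= u -> u ^+ 2 <= u' -> 0 <= iota <= 1 ->
  a ^+ N <= N%:R * (u + iota) -> (2 * N ^ 2 <= N')%N ->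
  a ^+ N' <= N'%:R * (u' + iota).
Proof.
move=> /andP[a0 a1] u0 uu' /andP[i0 i1] aN NN'.
case: N aN NN' => [|N] aN NN'; first by move: aN; rewrite expr0 mul0r ler10.
have n1 : (N.+1 * 2 <= N')%N by rewrite (leq_trans _ NN')// mulnC leq_mul2l leq_pmull.
apply: (@le_trans _ _ ((a ^+ N.+1) ^+ 2)).
  by rewrite -exprM ler_wiXn2l.
apply: (@le_trans _ _ ((2 * N.+1 ^ 2)%:R * (u' + iota))); last first.
  by rewrite ler_wpM2r ?ler_nat// addr_ge0// (le_trans _ uu')// sqr_ge0.
apply: (@le_trans _ _ ((N.+1%:R * (u + iota)) ^+ 2)).
  by rewrite lerXn2r ?nnegrE ?exprn_ge0 ?mulr_ge0 ?addr_ge0.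
rewrite exprMn natrM natrX -[leRHS]mulrA [leRHS]mulrCA ler_wpM2l ?sqr_ge0//.
have : iota ^+ 2 <= iota by rewrite expr2 ler_piMr.
have := sqr_ge0 (u - iota); rewrite sqrrB sqrrD; lra.
Qed.

(** Since [U s f ^+ 2 <= U s.+1 f], bounds of this shape survive an increase of [s] followed by one
    of [N]. Finitely many of them can thus be brought to common parameters. *)
Lemma bound_raise (R : realType) (s s' N : nat) : (s <= s')%N ->
  exists N0 : nat, forall (N' p : nat) (f : 'F_p -> R[i]) (a iota : R), (N0 <= N')%N ->
    0 <= a <= 1 -> 0 <= iota <= 1 ->
    a ^+ N <= N%:R * (U s f + iota) -> a ^+ N' <= N'%:R * (U s' f + iota).
Proof.
elim: s' => [|s' IH]; [|rewrite leq_eqVlt => /predU1P[->|]].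
- rewrite leqn0 => /eqP->; exists N => N' p f a i NN' a01 /andP[i0 _] aN.
  apply: le_trans (_ : a ^+ N <= _); first by case/andP: a01 => *; rewrite ler_wiXn2l.
  by apply: le_trans aN _; rewrite ler_wpM2r ?ler_nat// addr_ge0 ?U_ge0.
- exists N => N' p f a i NN' a01 /andP[i0 _] aN.
  apply: le_trans (_ : a ^+ N <= _); first by case/andP: a01 => *; rewrite ler_wiXn2l.
  by apply: le_trans aN _; rewrite ler_wpM2r ?ler_nat// addr_ge0 ?U_ge0.
- rewrite ltnS => /IH[N0 H]; exists (2 * N0 ^ 2)%N => N' p f a i NN' a01 i01 aN.
  apply: (bound_raise1 a01 (U_ge0 s' f) (U_sqr s' f) i01 _ NN').
  exact: H.
Qed.

Lemma ex_common (P : nat -> nat -> nat -> Prop) (D : nat) :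
  (forall e s N, P e s N -> forall s', (s <= s')%N ->
     exists N0, forall N', (N0 <= N')%N -> P e s' N') ->
  (forall e, (e < D)%N -> exists s N, P e s N) ->
  exists s N, forall e, (e < D)%N -> P e s N.
Proof.
move=> mono; suff H : (forall e, (e < D)%N -> exists s N, P e s N) ->
    exists s, forall s', (s <= s')%N -> exists N0, forall N', (N0 <= N')%N ->
      forall e, (e < D)%N -> P e s' N'.
  by move=> /H[s /(_ s (leqnn s))[N0 /(_ N0 (leqnn N0)) HH]]; exists s, N0.
elim: D => [|D IH] ex; first by exists 0%N => s' _; exists 0%N.
have [s1 H1] := IH (fun e De => ex e (leqW De)).
have [s2 [N2 P2]] := ex D (leqnn _).
exists (maxn s1 s2) => s'; rewrite geq_max => /andP[s1s' s2s'].
have [N1 H1'] := H1 s' s1s'; have [N3 H3] := mono _ _ _ P2 s' s2s'.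
exists (maxn N1 N3) => N'; rewrite geq_max => /andP[N1N' N3N'] e.
by rewrite ltnS leq_eqVlt => /predU1P[->|/H1']; [apply: H3|apply].
Qed.

(** The weights allowed after a step whose base point has index [e]: one class less at [e], no more
    above, anything up to [M] below. *)
Definition upd (v : nat -> nat) (e M : nat) : nat -> nat :=
  fun e' => if (e < e')%N then v e' else if e' == e then (v e).-1 else M.

(** Lexicographic induction, the highest index being most significant. In the inner induction on
    [v j], a later decrease at a higher index overwrites all that happened at [j], so the hypothesis
    on [v] itself covers it. *)
Lemma lex_ind (D : nat) (P : (nat -> nat) -> Prop) :
  (forall v, (forall e, (e < D)%N -> (0 < v e)%N -> forall M, P (upd v e M)) -> P v) ->
  forall v, P v.
Proof.
move=> step.
suff H j : (j <= D)%N -> forall v, (forall e, (j <= e < D)%N -> (0 < v e)%N ->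
    forall M, P (upd v e M)) -> P v.
  by move=> v; apply: (H D) => // e /andP[De]; rewrite ltnNge De.
elim: j => [|j IH] jD v Hv; first by apply: step => e eD; apply: Hv.
have [n vj] : exists n, v j = n by exists (v j).
elim: n v vj Hv => [|n IHn] v vj Hv; apply: IH (ltnW jD) _ _ => e /andP[];
  rewrite leq_eqVlt => /predU1P[<-|je] eD ve M; try by apply: Hv => //; rewrite je.
  by move: ve; rewrite vj ltnn.
apply: IHn => [|e' /andP[je' e'D] ve' M'].
  by rewrite /upd ltnn eqxx vj.
have -> : upd (upd v j M) e' M' = upd v e' M'.
  apply: funext => i; rewrite /upd je'; case: ltnP => // e'i.
  by rewrite (ltn_trans je' e'i).
by apply: Hv; rewrite ?je'//; move: ve'; rewrite /upd je'.
Qed.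

Lemma invp_01 (R : realType) p : prime p -> 0 <= (p%:R : R)^-1 <= 1.
Proof.
move=> pp; rewrite invr_ge0 ler0n invf_le1 ?ltr0n ?ler1n ?prime_gt0//.
Qed.

Section PET.
Variable R : realType.
Local Notation C := R[i].

(** [N] is both exponent and constant, so that one number records the quality of the bound,
    uniformly in [p]. The controlled function [f1] sits at a polynomial of largest size. *)
Definition pet (D : nat) (v : nat -> nat) (m s N : nat) : Prop :=
  forall p, prime p -> (D < p)%N ->
  forall (f0 f1 : {ffun 'F_p -> C}) (Q1 : {poly 'F_p})
    (L : seq ({poly 'F_p} * {ffun 'F_p -> C})),
  bdd ((0, f0) :: (Q1, f1) :: L) ->
  uniq [seq nc q.1 | q <- (0, f0) :: (Q1, f1) :: L] ->
  (forall q, q \in L -> (size q.1 <= size Q1)%N) ->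
  (size Q1 <= D.+1)%N -> (size L <= m)%N ->
  (forall e, (e < D)%N -> (wt e [seq q.1 | q <- (Q1, f1) :: L] <= v e)%N) ->
  nm (Lam ((0, f0) :: (Q1, f1) :: L)) ^+ N <= N%:R * (U s f1 + p%:R^-1).

Lemma pet_raise D v m s N : pet D v m s N -> forall s', (s <= s')%N ->
  exists N0, forall N', (N0 <= N')%N -> pet D v m s' N'.
Proof.
move=> H s' ss'; have [N0 H0] := bound_raise R N ss'; exists N0 => N' NN'.
move=> p pp Dp f0 f1 Q1 L bL *; apply: H0 => //; last exact: H.
  by rewrite nm_ge0 Lam_le1.
exact: invp_01.
Qed.

Lemma nc0_size (K : fieldType) (Q : {poly K}) : (nc Q != nc 0) = (1 < size Q)%N.
Proof. by rewrite nc_eq subr0 ltnNge. Qed.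

Lemma ncB (K : fieldType) (Q B : {poly K}) : nc (Q - B) = nc Q - nc B.
Proof. by rewrite /nc coefB polyCB opprD addrACA -opprD. Qed.

Lemma wt_le_size (K : fieldType) e (ls : seq {poly K}) : (wt e ls <= size ls)%N.
Proof.
by rewrite (leq_trans (size_undup _))// size_map size_filter count_size.
Qed.

(** Subtracting the base point of [vdp_base] brings the family back to the form of [pet], with
    lexicographically smaller weights and at most [2 * m.+1] members. The controlled function stays
    attached to [Q1], differentiated if [Q1] is linear. *)
Lemma pet_good_h D v m s N p (h : 'F_p) f1 Q1
    (L : seq ({poly 'F_p} * {ffun 'F_p -> C})) :
  (forall e, (e < D)%N -> (0 < v e)%N ->
    pet D (upd v e (2 * m.+1)) (2 * m.+1) s N) ->
  prime p -> (D < p)%N -> bdd ((Q1, f1) :: L) ->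
  (forall q, q \in (Q1, f1) :: L -> (1 < size q.1 <= size Q1)%N) ->
  (size Q1 <= D.+1)%N -> (size L <= m)%N ->
  (forall e, (e < D)%N -> (wt e [seq q.1 | q <- (Q1, f1) :: L] <= v e)%N) ->
  (L != [::]) || (2 < size Q1)%N ->
  uniq (map (@nc _) (vdp h [seq q.1 | q <- (Q1, f1) :: L])) ->
  nm (Lam (vd h ((Q1, f1) :: L))) ^+ N <=
    N%:R * (U s (if (size Q1 <= 2)%N then Dl (lead_coef Q1 * h) f1 else f1) + p%:R^-1).
Proof.
move=> H pp Dp bL sL sQ1 Lm wv nb ugood.
set L1 := (Q1, f1) :: L in bL sL wv ugood *; set ls := [seq q.1 | q <- L1] in wv ugood.
have sls Q : Q \in Q1 :: [seq q.1 | q <- L] -> (1 < size Q <= size Q1)%N.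
  by rewrite -[_ :: _]/ls => /mapP[q qL ->]; apply: sL.
have nb' : ([seq q.1 | q <- L] != [::]) || (2 < size Q1)%N by case: (L) nb.
have [B Brest [e eD [we sB sB1 wlt wle]]] := vdp_base (D := D) h sls sQ1 nb'.
pose g : {ffun 'F_p -> C} :=
  if (size Q1 <= 2)%N then [ffun x => Dl (lead_coef Q1 * h) f1 x] else f1.
have gE : (g : _ -> _) = if (size Q1 <= 2)%N then Dl (lead_coef Q1 * h) f1 else f1.
  by rewrite /g; case: ifP => // _; apply: ffun_funE.
rewrite -gE.
have vdE : vd h L1 = (Q1, g) :: behead (vd h L1).
  by rewrite /vd /= /vd1 /= /g; case: ifP.
set rest := behead (vd h L1) in vdE.
have vdpE : vdp h ls = [seq q.1 | q <- vd h L1] by rewrite vd_vdp.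
have : B \in [seq q.1 | q <- rest].
  by move: Brest; rewrite -[_ :: _]/ls vdpE vdE.
case/mapP => b brest BE.
have pe : perm_eq (vd h L1) (b :: (Q1, g) :: rem b rest).
  rewrite vdE (perm_trans (_ : perm_eq _ ((Q1, g) :: b :: rem b rest)))//.
    by rewrite perm_cons perm_to_rem.
  by rewrite -[X in perm_eq X]/([:: (Q1, g)] ++ [:: b] ++ rem b rest) perm_catCA.
have svd : (size (vd h L1) <= 2 * m.+1)%N.
  by rewrite (leq_trans (size_vd _ _))// leq_mul2l /= ltnS.
have srem : (size (rem b rest) < size rest)%N.
  by rewrite size_rem// ltn_predL; case: (rest) brest.
have srest : (size rest < 2 * m.+1)%N by move: svd; rewrite vdE.
rewrite (Lam_perm pe) -(Lam_shift B) /= -BE subrr.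
have vdpB q : q \in b :: (Q1, g) :: rem b rest -> q.1 \in vdp h ls.
  by move=> qin; rewrite vdpE map_f// (perm_mem pe).
apply: (H e eD); rewrite ?(leq_trans we)// ?wv//.
- move=> q; rewrite -[(0, _) :: _](_ : [seq (q.1 - B, q.2) | q <- b :: (Q1, g) :: rem b rest] = _).
    by case/mapP => q' q'in -> x /=; apply: (bdd_vd (h := h) bL); rewrite (perm_mem pe).
  by rewrite /= -BE subrr.
- rewrite -[(0, _) :: _](_ : [seq (q.1 - B, q.2) | q <- b :: (Q1, g) :: rem b rest] = _);
    last by rewrite /= -BE subrr.
  rewrite -map_comp (eq_map (g := (fun P => P - nc B) \o (@nc _ \o fst))); last first.
    by move=> q /=; rewrite ncB.
  rewrite map_comp map_inj_uniq; last by move=> x y /addIr.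
  by rewrite -(perm_uniq (perm_map _ pe)) map_comp -vdpE.
- move=> _ /mapP[q qin ->] /=; apply: sB; apply: vdpB.
  by rewrite !inE qin !orbT.
- exact: leq_trans sB1 sQ1.
- by rewrite size_map (leq_trans (ltnW srem))// ltnW.
- move=> e' e'D; set S := map _ _.
  have SE : S = [seq q.1 - B | q <- (Q1, g) :: rem b rest].
    by rewrite /S /= -map_comp.
  have wS i : (wt i S <= wt i [seq (Q - B)%R | Q <- vdp h ls])%N.
    apply: wt_sub => Q; rewrite SE => /mapP[q qin ->] sq.
    exists (q.1 - B); last by split.
    apply/mapP; exists q.1 => //; apply: vdpB.
    by rewrite inE qin orbT.
  rewrite /upd; case: ltnP => [ee'|e'e].
    by rewrite (leq_trans (wS e'))// (leq_trans (wle _ ee'))// wv.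
  case: eqP => [->|_].
    rewrite -ltnS prednK ?(leq_trans we (wv e eD))//.
    exact: leq_ltn_trans (wS e) (leq_trans wlt (wv e eD)).
  rewrite (leq_trans (wt_le_size _ _))// SE size_map /=.
  exact: leq_ltn_trans (ltnW srem) srest.
Qed.

Lemma pet_ex D v m : exists s N, pet D v m s N.
Proof.
elim/(lex_ind (D := D)): v m => v IH m.
pose M := (2 * m.+1)%N.
have [s [N H]] : exists s N, forall e, (e < D)%N -> (0 < v e)%N ->
    pet D (upd v e M) M s N.
  apply: (ex_common (P := fun e s N => (0 < v e)%N -> pet D (upd v e M) M s N)).
    move=> e s N; case: (posnP (v e)) => [_ _ s' _|ve /(_ isT) He s' ss'].
      by exists 0%N.
    by have [N0 HN] := pet_raise He ss'; exists N0 => N' NN' _; apply: HN.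
  move=> e eD; have [ve|ve] := posnP (v e); first by exists 0%N, 0%N.
  by have [s [N HN]] := IH e eD ve M M; exists s, N.
(* As exponent: the van der Corput square doubles [N]. As constant: the bad [h] contribute at most
   [m.+1 ^ 2 / p]. *)
pose N2 := (2 * N + m.+1 ^ 2)%N.
(* Three endings: [Q1] is not linear; [Q1] is linear and the mean over [h] raises the degree by one;
   a lone linear polynomial, where [a ^+ 4 <= U 1 f1]. *)
have [Na Ha] := bound_raise R N2 (leqnSn s).
have [Nb Hb] := bound_raise R N2 (leqnn s.+1).
have [Nc Hc] := bound_raise R 4 (isT : (1 <= s.+1)%N).
exists s.+1, (maxn Na (maxn Nb Nc)) => p pp Dp f0 f1 Q1 L bL uL sL sQ1 Lm wv.
set NN := maxn Na _; set a := nm _.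
have [aN [bN cN]] : (Na <= NN)%N /\ (Nb <= NN)%N /\ (Nc <= NN)%N.
  by rewrite /NN !leq_max !leqnn !orbT.
have a01 : 0 <= a <= 1 by rewrite nm_ge0 Lam_le1.
have [a0 a1] := andP a01.
have i01 := invp_01 R pp; have [i0 _] := andP i01.
have bL1 : bdd ((Q1, f1) :: L) by move=> q qL; apply: bL; rewrite inE qL orbT.
have b0 x : nm (f0 x) <= 1 by apply: (bL (0, f0)); rewrite mem_head.
have b1 x : nm (f1 x) <= 1 by apply: (bL1 (Q1, f1)); rewrite mem_head.
have snc q : q \in (Q1, f1) :: L -> (1 < size q.1 <= size Q1)%N.
  move=> qL; apply/andP; split; last first.
    by move: qL; rewrite inE => /predU1P[->//|/sL].
  rewrite -nc0_size; move: uL => /=/andP[+ _]; apply: contraNneq => <-.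
  by rewrite -[X in _ \in X]/[seq nc q.1 | q <- (Q1, f1) :: L] (map_f (fun q => nc q.1)).
have vdc : a ^+ 2 <= mean (fun h => nm (Lam (vd h ((Q1, f1) :: L)))).
  by apply: Lam_vdc => // q /snc /andP[].
have [nb|] := boolP ((L != [::]) || (2 < size Q1)%N); last first.
  rewrite negb_or negbK -leqNgt => /andP[/eqP L0 s2].
  apply: Hc => //; apply: (@le_trans _ _ (U 1 f1)); last first.
    rewrite -[leLHS]mul1r ler_pM ?U_ge0// ?ler1n// lerDl//.
  have lc0 : lead_coef Q1 != 0.
    have := snc _ (mem_head _ _); rewrite lead_coef_eq0 -size_poly_gt0 => /andP[+ _].
    exact: ltnW.
  rewrite -[4%N]/(2 * 2)%N exprM.
  apply: (@le_trans _ _ (mean (fun h => nm (Lam (vd h ((Q1, f1) :: L)))) ^+ 2)).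
    by rewrite lerXn2r ?nnegrE ?sqr_ge0// mean_ge0// => h; apply: nm_ge0.
  apply: le_trans (mean_pow 2 (Fp_gt0 p) _) _; first by move=> h; apply: nm_ge0.
  rewrite /= -(mean_bij (h := fun h => lead_coef Q1 * h)
    (fun a => nm (mean (Dl a f1)) ^+ 2)); last first.
    by exists (fun h => (lead_coef Q1)^-1 * h) => h; rewrite ?mulKf ?mulVKf.
  apply: ler_mean => h; rewrite L0 /vd /= cats0 /vd1 /= s2 /Lam.
  rewrite mean_exchange (eq_mean (g := fun _ => mean (Dl (lead_coef Q1 * h) f1))).
    by rewrite (mean_cst (Fp_gt0 p)).
  move=> d; rewrite -[RHS](mean_shift _ Q1.[d]); apply: eq_mean => x.
  by rewrite big_seq1 /= ffunE.
pose fh h := if (size Q1 <= 2)%N then Dl (lead_coef Q1 * h) f1 else f1.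
pose ls := [seq q.1 | q <- (Q1, f1) :: L].
pose bad h : R := (~~ uniq (map (@nc _) (vdp h ls)))%:R.
have lebad : mean bad <= (m.+1 ^ 2)%:R / p%:R.
  apply: le_trans (mean_bad R pp _ _) _.
  - move=> _ /mapP[q /snc /andP[_ sq] ->]; rewrite (leq_trans sq)// (leq_trans sQ1)//.
  - by rewrite -map_comp; move: uL => /andP[_].
  - by rewrite ler_wpM2r ?invr_ge0 ?ler0n// ler_nat leq_exp2r// size_map /= ltnS.
have main : a ^+ N2 <= N2%:R * (mean (fun h => U s (fh h)) + p%:R^-1).
  have u0 : 0 <= mean (fun h => U s (fh h)) by apply: mean_ge0 => h; apply: U_ge0.
  apply: (@le_trans _ _ ((a ^+ 2) ^+ N)); first by rewrite -exprM ler_wiXn2l// leq_addr.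
  apply: (@le_trans _ _ (mean (fun h => nm (Lam (vd h ((Q1, f1) :: L)))) ^+ N)).
    by rewrite lerXn2r ?nnegrE ?sqr_ge0// mean_ge0// => h; apply: nm_ge0.
  apply: le_trans (mean_pow N (Fp_gt0 p) _) _; first by move=> h; apply: nm_ge0.
  apply: (@le_trans _ _ (mean (fun h => N%:R * (U s (fh h) + p%:R^-1) + bad h))).
    apply: ler_mean => h; rewrite /bad; have [uh|nuh] := boolP (uniq _).
      by rewrite addr0; apply: (pet_good_h H).
    apply: (@le_trans _ _ 1).
      by rewrite exprn_ile1 ?nm_ge0// Lam_le1//; apply: bdd_vd.
    by rewrite lerDr mulr_ge0// addr_ge0 ?U_ge0.
  rewrite meanD meanMl meanD (mean_cst (Fp_gt0 p)).
  rewrite /N2 natrD natrM mulrDl; apply: lerD.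
    by rewrite ler_wpM2r ?addr_ge0// ler_peMl ?ler0n// ler1n.
  by apply: le_trans lebad _; rewrite ler_wpM2l ?ler0n// lerDr.
have [s2|s2] := leqP (size Q1) 2.
  apply: Hb => //; move: main; rewrite /fh s2.
  rewrite (mean_bij (h := fun h => lead_coef Q1 * h) (fun h => U s (Dl h f1)))//.
  have lc0 : lead_coef Q1 != 0.
    have := snc _ (mem_head _ _); rewrite lead_coef_eq0 -size_poly_gt0 => /andP[+ _].
    exact: ltnW.
  by exists (fun h => (lead_coef Q1)^-1 * h) => h; rewrite ?mulKf ?mulVKf.
apply: Ha => //; move: main; rewrite /fh leqNgt s2 /=.
by rewrite (mean_cst (Fp_gt0 p)).
Qed.

End PET.

(** * Independence of polynomial averages *)

Section Family.
Variables (R : realType) (p n : nat).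
Local Notation C := R[i].
Local Notation F := 'F_p.
Implicit Types (Q : 'I_n -> {poly F}) (f : 'I_n -> F -> C).

Definition LamI Q f : C :=
  mean (fun x => mean (fun d => \prod_i f i (x + (Q i).[d]))).

(** Testing only coefficients of sum zero makes the notion invariant under subtracting one
    polynomial from all, so any index can be moved to the base point. *)
Definition aff_indep Q : Prop :=
  forall c : 'I_n -> F, \sum_i c i = 0 -> (size (\sum_i c i *: Q i)%R <= 1)%N ->
  forall i, c i = 0.

Definition pseudochar (chi : F -> C) (g : F -> C) : Prop :=
  exists k xi, nm k <= 1 /\ forall x, g x = k * chi (xi * x).

Definition setf f b g : 'I_n -> F -> C := fun i => if i == b then g else f i.

Lemma aff_indep_size Q i j : aff_indep Q -> i != j -> (1 < size (Q i - Q j)%R)%N.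
Proof.
move=> indQ ij; rewrite ltnNge; apply/negP => s1.
pose c k : F := (k == i)%:R - (k == j)%:R.
have S (g : 'I_n -> {poly F}) : \sum_k c k *: g k = g i - g j.
  rewrite (bigD1 i)//= (bigD1 j)//=; last by rewrite eq_sym.
  rewrite big1 => [|k /andP[/negPf ki /negPf kj]]; last first.
    by rewrite /c ki kj subr0 scale0r.
  by rewrite /c !eqxx (negPf ij) eq_sym (negPf ij) subr0 sub0r scale1r scaleN1r addr0.
have c0 : \sum_k c k = 0.
  rewrite (bigD1 i)//= (bigD1 j)//=; last by rewrite eq_sym.
  rewrite big1 => [|k /andP[/negPf ki /negPf kj]]; last by rewrite /c ki kj subr0.
  by rewrite /c !eqxx (negPf ij) eq_sym (negPf ij) subr0 sub0r addr0 subrr.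
have := indQ c c0; rewrite S => /(_ s1 i).
by rewrite /c eqxx (negPf ij) subr0 => /eqP; rewrite oner_eq0.
Qed.

Lemma LamI_dual Q f b : LamI Q f =
  mean (fun x => f b x *
    mean (fun d => \prod_(i | i != b) f i (x + (Q i).[d] - (Q b).[d]))).
Proof.
under [RHS]eq_mean do rewrite -meanMl.
rewrite /LamI [LHS]mean_exchange [RHS]mean_exchange; apply: eq_mean => d.
rewrite -[RHS](mean_shift _ (Q b).[d]); apply: eq_mean => x.
rewrite (bigD1 b)//=; congr (_ * _); apply: eq_bigr => i _.
by congr (f i _); ring.
Qed.

Lemma LamI_linear Q f b (g h : F -> C) k :
  LamI Q (setf f b (fun x => g x + k * h x)) =
  LamI Q (setf f b g) + k * LamI Q (setf f b h).
Proof.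
rewrite !(LamI_dual _ _ b) -meanMl -meanD; apply: eq_mean => x.
rewrite /setf eqxx.
have E (g' : F -> C) : mean (fun d => \prod_(i | i != b)
    (if i == b then g' else f i) (x + (Q i).[d] - (Q b).[d])) =
  mean (fun d => \prod_(i | i != b) f i (x + (Q i).[d] - (Q b).[d])).
  by apply: eq_mean => d; apply: eq_bigr => i /negPf->.
by rewrite !E; ring.
Qed.

Lemma eq_LamI Q f f' : f =2 f' -> LamI Q f = LamI Q f'.
Proof.
by move=> ff'; apply: eq_mean => x; apply: eq_mean => d; apply: eq_bigr => i _.
Qed.

Lemma setf_le1 f b g : (forall i x, nm (f i x) <= 1) -> (forall x, nm (g x) <= 1) ->
  forall i x, nm (setf f b g i x) <= 1.
Proof. by move=> f1 g1 i x; rewrite /setf; case: eqP. Qed.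

Lemma pseudochar_cst chi k : is_chi chi -> nm k <= 1 -> pseudochar chi (fun _ => k).
Proof. by move=> chiP k1; exists k, 0; split=> // x; rewrite mul0r (chi0 chiP) mulr1. Qed.

End Family.

(** The base point [i0] maximizes the size of [Q b - Q i0]. As
    [Q j - Q i0 = (Q b - Q i0) - (Q b - Q j)], the polynomial of [b] then has the largest size, as
    [pet] requires of the controlled function. *)
Lemma pet_family (R : realType) (n D : nat) : exists s N : nat,
  forall p, prime p -> (D < p)%N ->
  forall (Q : 'I_n -> {poly 'F_p}) (f : 'I_n -> 'F_p -> R[i]) (a b : 'I_n),
  aff_indep Q -> (forall i, (size (Q i) <= D.+1)%N) ->
  (forall i x, nm (f i x) <= 1) -> a != b ->
  nm (LamI Q f) ^+ N <= N%:R * (U s (f b) + p%:R^-1).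
Proof.
have [s [N H]] := pet_ex R D (fun _ => n) n; exists s, N => p pp Dp Q f a b indQ sQ f1 ab.
pose i0 := [arg max_(i > a | i != b) size (Q b - Q i)%R]%N.
have [i0b i0max] : i0 != b /\ forall i, i != b -> (size (Q b - Q i)%R <= size (Q b - Q i0)%R)%N.
  by rewrite /i0; case: arg_maxnP.
pose e i : {poly 'F_p} * {ffun 'F_p -> R[i]} := (Q i, [ffun x => f i x]).
have LE : LamI Q f = Lam [seq e i | i <- index_enum 'I_n].
  apply: eq_mean => x; apply: eq_mean => d; rewrite big_map.
  by apply: eq_bigr => i _; rewrite /= ffunE.
pose r := rem b (rem i0 (index_enum 'I_n)).
have bi0 : b \in rem i0 (index_enum 'I_n).
  by rewrite mem_rem_uniq ?index_enum_uniq// !inE eq_sym i0b mem_index_enum.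
have pe : perm_eq (index_enum 'I_n) (i0 :: b :: r).
  rewrite (perm_trans (perm_to_rem (mem_index_enum i0)))// perm_cons.
  exact: perm_to_rem.
have ur : uniq (i0 :: b :: r) by rewrite -(perm_uniq pe) index_enum_uniq.
have sr : (size r).+2 = n.
  by have := perm_size pe; rewrite -sum1_size big_const_ord iter_addn mul1n addn0 => /esym.
have sub_le i j : (size (Q i - Q j)%R <= D.+1)%N.
  by rewrite (leq_trans (size_polyD _ _))// size_polyN geq_max !sQ.
rewrite LE (Lam_perm (perm_map e pe)) -(Lam_shift (Q i0)) /= subrr.
rewrite -[X in U s X]ffun_funE.
have E : (0, [ffun x => f i0 x]) :: (Q b - Q i0, [ffun x => f b x]) ::
    [seq (q.1 - Q i0, q.2) | q <- [seq e i | i <- r]] =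
    [seq (Q i - Q i0, [ffun x => f i x]) | i <- i0 :: b :: r].
  by rewrite /= subrr -map_comp.
apply: H => //.
- by rewrite E => _ /mapP[i _ ->] x /=; rewrite ffunE.
- rewrite E -map_comp map_inj_in_uniq// => i j _ _ /= /eqP.
  rewrite nc_eq opprB addrA subrK leqNgt => nij.
  apply/eqP; apply: contraNT nij; exact: aff_indep_size.
- move=> _ /mapP[_ /mapP[j jr ->] ->] /=.
  have jb : j != b.
    by apply: contraTneq jr => ->; move: ur => /= /andP[_ /andP[]].
  have -> : Q j - Q i0 = (Q b - Q i0) - (Q b - Q j) by ring.
  by rewrite (leq_trans (size_polyD _ _))// size_polyN geq_max leqnn i0max.
- by rewrite !size_map -[leqRHS]sr -addn2 leq_addr.
- move=> e' _; rewrite (leq_trans (wt_le_size _ _))//= !size_map.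
  by rewrite -[X in (_ <= X)%N]sr.
Qed.

(** Degree lowering iterated down to [U 0], a squared mean. If the norm at [s.+1] exceeded [delta],
    the one at [s] would be at least [e], against the bound [e / 2] from the induction. *)
Lemma U_small (R : realType) s (delta : R) : 0 < delta ->
  exists2 tau : R, 0 < tau & forall p (chi : 'F_p -> R[i]) (Fd : 'F_p -> 'F_p -> R[i]),
  is_chi chi -> (forall d x, nm (Fd d x) <= 1) ->
  (forall l eta, eta != 0 ->
    nm (mean (fun x => mean (fun d =>
      bx l (fun s => Fd d (x - \sum_(y <- s) y)) * chi (eta * x)))) ^+ 2 <= tau) ->
  U 0 (fun x => mean (fun d => Fd d x)) <= tau ->
  U s (fun x => mean (fun d => Fd d x)) <= delta.
Proof.
elim: s delta => [|s IH] delta d0.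
  by exists delta.
pose c := (delta / 2) ^+ (2 ^ s) / 2.
have c0 : 0 < c by rewrite divr_gt0// exprn_gt0// divr_gt0.
pose e := (delta / 2 * c) ^+ (2 ^ s).
have e0 : 0 < e by rewrite exprn_gt0// mulr_gt0// divr_gt0.
have [t1 t10 H] := IH (e / 2) ltac:(by rewrite divr_gt0).
exists (Num.min t1 c); first by rewrite lt_min t10.
move=> p chi Fd chiP Fd1 small U0.
have [//|dU] := leP (U s.+1 _) delta.
have := degree_lowering (t := s) (delta := delta) (tau := Num.min t1 c) chiP Fd1.
move=> /(_ (fun l eta _ => small l eta)); rewrite -/c -/e.
have -> : 0 <= Num.min t1 c by rewrite le_min !ltW.
move=> /(_ isT (ltW d0) (ltW dU)); rewrite ge_min lexx orbT => /(_ isT) eU.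
have : U s (fun x => mean (fun d => Fd d x)) <= e / 2.
  apply: (H p chi) => // [l eta eta0|].
    by apply: le_trans (small l eta eta0) _; rewrite ge_min lexx.
  by apply: le_trans U0 _; rewrite ge_min lexx.
lra.
Qed.

Lemma chi_sum (R : realType) p (chi : 'F_p -> R[i]) (I : finType) (P : pred I)
    (g : I -> 'F_p) : is_chi chi ->
  chi (\sum_(i | P i) g i) = \prod_(i | P i) chi (g i).
Proof. by move=> chiP; apply: big_morph; [exact: chiD|exact: chi0]. Qed.

Lemma root_small (R : realType) (D : nat) (delta : R) : 0 < delta ->
  exists p0 : nat, forall p : nat, (p0 <= p)%N -> (0 < p)%N ->
  forall (n : nat) (a : R), (n <= D)%N -> 0 <= a <= 1 ->
  a ^+ (2 ^ n) <= n%:R / p%:R -> a <= delta.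
Proof.
move=> d0; have e0 : 0 < delta ^+ (2 ^ D) by rewrite exprn_gt0.
exists (Num.bound (D%:R / delta ^+ (2 ^ D))) => p pp p0 n a nD /andP[a0 a1] an.
suff : a ^+ (2 ^ D) <= delta ^+ (2 ^ D).
  by rewrite ler_pXn2r ?expn_gt0// nnegrE// ltW.
apply: (@le_trans _ _ (a ^+ (2 ^ n))); first by rewrite ler_wiXn2l// leq_exp2l.
apply: le_trans an _; rewrite ler_pdivrMr ?ltr0n// mulrC -ler_pdivrMr//.
apply: (@le_trans _ _ (D%:R / delta ^+ (2 ^ D))).
  by rewrite ler_wpM2r ?ler_nat// invr_ge0 ltW.
apply: ltW; apply: lt_le_trans (archi_boundP _) _; last by rewrite ler_nat.
by rewrite divr_ge0// ltW.
Qed.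

(** * Induction on the number of functions that are not characters *)

Section Claim.
Variable R : realType.
Local Notation C := R[i].

Definition claim (n D m : nat) : Prop := forall delta : R, 0 < delta ->
  exists p0 : nat, forall p, prime p -> (p0 <= p)%N ->
  forall (chi : 'F_p -> C) (Q : 'I_n -> {poly 'F_p}) (f : 'I_n -> 'F_p -> C)
    (A : {set 'I_n}),
  is_chi chi -> aff_indep Q -> (forall i, (size (Q i) <= D.+1)%N) ->
  (forall i x, nm (f i x) <= 1) -> (#|A| <= m)%N ->
  (forall i, i \notin A -> pseudochar chi (f i)) ->
  nm (LamI Q f - \prod_i mean (f i)) <= delta.

(** Translating [x] by the polynomial of [a] splits off a Weyl sum of [P]. If all frequencies off
    [a] vanish the identity is exact; otherwise the product of the means is zero, and affine
    independence makes [P] nonconstant. *)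
Lemma claim1 n D : claim n D 1.
Proof.
move=> delta d0; have [p1 Hp1] := root_small D d0.
exists (maxn p1 D.+1) => p pp; rewrite geq_max => /andP[p1p Dp].
move=> chi Q f A chiP indQ sQ f1 A1 Aps.
case: n Q f A indQ sQ f1 A1 Aps => [|n] Q f A indQ sQ f1 A1 Aps.
  have -> : LamI Q f = 1.
    rewrite /LamI (eq_mean (g := fun _ => 1)) ?(mean_cst (Fp_gt0 p))// => x.
    by rewrite (eq_mean (g := fun _ => 1)) ?(mean_cst (Fp_gt0 p))// => d; rewrite big_ord0.
  by rewrite big_ord0 subrr nm0 ltW.
have [a Aa] : exists a, A \subset [set a].
  move: A1; rewrite leq_eqVlt ltnS leqn0 => /orP[/cards1P[a ->]|]; first by exists a.
  by rewrite cards_eq0 => /eqP->; exists ord0; rewrite sub0set.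
have [kx Hkx] : {kx : 'I_n.+1 -> C * 'F_p & forall i, i != a ->
    nm (kx i).1 <= 1 /\ forall x, f i x = (kx i).1 * chi ((kx i).2 * x)}.
  apply: (choice (P := fun i y => i != a ->
    nm y.1 <= 1 /\ forall x, f i x = y.1 * chi (y.2 * x))) => i.
  have [->|ia] := eqVneq i a; first by exists (0, 0).
  have [|k [xi [k1 kE]]] := Aps i; last by exists (k, xi).
  by apply: contra ia => /(subsetP Aa); rewrite inE.
pose xi i := (kx i).2; pose K := \prod_(i | i != a) (kx i).1.
pose P := \sum_(i | i != a) xi i *: (Q i - Q a).
pose Xi := \sum_(i | i != a) xi i.
have K1 : nm K <= 1 by apply: nm_prod_le1 => i /Hkx[].
have LE : LamI Q f = K * mean (fun x => f a x * chi (Xi * x)) *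
    mean (fun d => chi P.[d]).
  rewrite (LamI_dual _ _ a) -[K * _]meanMl -[RHS]meanMr; apply: eq_mean => x.
  rewrite -!mulrA [RHS]mulrCA; congr (_ * _); rewrite mulrA -[RHS]meanMl.
  apply: eq_mean => d; rewrite /Xi mulr_suml /P horner_sum !chi_sum// -!big_split.
  apply: eq_bigr => i ia /=; have [_ ->] := Hkx i ia.
  rewrite -mulrA -(chiD chiP); congr (_ * chi _).
  by rewrite hornerZ hornerD hornerN /xi; ring.
have [/forall_inP xi0|] := boolP [forall (i | i != a), xi i == 0].
  have -> : LamI Q f = \prod_i mean (f i).
    rewrite LE (bigD1 a)//= /K.
    have -> : P = 0 by apply: big1 => i /xi0 /eqP->; rewrite scale0r.
    have -> : Xi = 0 by apply: big1 => i /xi0 /eqP->.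
    under eq_mean do rewrite mul0r (chi0 chiP) mulr1.
    under [X in _ * X = _]eq_mean do rewrite horner0 (chi0 chiP).
    rewrite (mean_cst (Fp_gt0 p)) mulr1 mulrC; congr (_ * _).
    apply: eq_bigr => i ia; have [_ fi] := Hkx i ia.
    have xii : (kx i).2 = 0 by apply/eqP/xi0.
    under eq_mean do rewrite fi xii mul0r (chi0 chiP) mulr1.
    by rewrite (mean_cst (Fp_gt0 p)).
  by rewrite subrr nm0 ltW.
case/forall_inPn => j; rewrite unfold_in => ja xij.
have -> : \prod_i mean (f i) = 0.
  rewrite (bigD1 j)//=; have [_ fj] := Hkx j ja.
  under eq_mean do rewrite fj.
  by rewrite meanMl (mean_chi chiP) (negPf xij) mulr0 mul0r.
rewrite subr0 LE nmM.
apply: (@le_trans _ _ (nm (mean (fun d => chi P.[d])))).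
  rewrite ler_piMl ?nm_ge0// nmM_le1// (nm_mean_le1 (Fp_gt0 p))// => x.
  by rewrite nmM_le1// (nm_chi chiP).
have sP : (size P <= D.+1)%N.
  rewrite (leq_trans (size_sum _ _ _))//; apply/bigmax_leqP => i ia.
  rewrite (leq_trans (size_scale_leq _ _))// (leq_trans (size_polyD _ _))//.
  by rewrite size_polyN geq_max !sQ.
have sP1 : (1 < size P)%N.
  rewrite ltnNge; apply: contra xij => sP1; apply/eqP.
  pose c i := if i == a then - Xi else xi i.
  have := indQ c; rewrite (bigD1 a)//= [X in _ + X](eq_bigr xi); last first.
    by move=> i /negPf; rewrite /c => ->.
  rewrite {1}/c eqxx addNr => /(_ erefl).
  have -> : \sum_i c i *: Q i = P.
    rewrite (bigD1 a)//= /c eqxx /P /Xi scaleNr scaler_suml -sumrN -big_split.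
    by apply: eq_bigr => i /negPf-> /=; rewrite scalerBr addrC.
  by move=> /(_ sP1 j); rewrite /c (negPf ja).
have [n' sPE] : exists n', size P = n'.+2 by exists (size P).-2; case: (size P) sP1 => [|[]].
apply: (Hp1 p p1p (prime_gt0 pp) n'); first by rewrite ltnW// -ltnS -sPE.
  rewrite nm_ge0 (nm_mean_le1 (Fp_gt0 p))// => d; by rewrite (nm_chi chiP).
by apply: weyl => //; rewrite -sPE (leq_trans sP).
Qed.

Lemma bx_pseudochar p (chi : 'F_p -> C) l (c : seq 'F_p -> 'F_p) (g : 'F_p -> C) :
  is_chi chi -> pseudochar chi g ->
  pseudochar chi (fun y => bx l (fun s => g (y - c s))).
Proof.
move=> chiP [k [xi [k1 gE]]].
have [k' [k'1 _ k'E]] := bx_chi chiP l predT (fun _ => xi) c.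
exists (bx l (fun _ => k) * k'), (alt l (fun _ => xi)); split.
  by apply: nmM_le1 => //; apply: bx_le1.
move=> x; rewrite -mulrA -k'E -bxM; congr bx; apply: funext => s.
by rewrite gE mul1r.
Qed.

(** Cauchy-Schwarz replaces [f b] by the conjugate of its dual function [G], and [pet_family] bounds
    the result by [U s G]. Both inputs of [U_small] are averages with a character in place of [f b],
    so [claim n D m] applies to them; the product of the means is zero because of the nontrivial
    character at [b] in the one, of [f a] in the other. *)
Lemma dual_small n D m : claim n D m -> forall delta : R, 0 < delta ->
  exists p0 : nat, forall p, prime p -> (p0 <= p)%N ->
  forall (chi : 'F_p -> C) (Q : 'I_n -> {poly 'F_p}) (f : 'I_n -> 'F_p -> C)
    (A : {set 'I_n}) (a b : 'I_n),
  is_chi chi -> aff_indep Q -> (forall i, (size (Q i) <= D.+1)%N) ->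
  (forall i x, nm (f i x) <= 1) -> (#|A| <= m.+1)%N ->
  (forall i, i \notin A -> pseudochar chi (f i)) ->
  b \in A -> a != b -> mean (f a) = 0 -> nm (LamI Q f) <= delta.
Proof.
move=> Hm delta d0; have [s [N HN]] := pet_family R n D.
(* Makes [N * (e + e)] at most [delta ^+ (2 * N)]. *)
pose e := delta ^+ (2 * N) / (2 * N.+1%:R).
have e0 : 0 < e by rewrite divr_gt0 ?exprn_gt0// mulr_gt0.
have [tau t0 Htau] := U_small s e0.
have [p1 Hp1] := Hm (Num.sqrt tau) ltac:(by rewrite sqrtr_gt0).
exists (maxn p1 (maxn D.+1 (Num.bound e^-1))) => p pp.
rewrite !geq_max => /andP[p1p /andP[Dp bp]] chi Q f A a b chiP indQ sQ f1 Am Aps bA ab fa0.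
pose Fd d x := \prod_(i | i != b) f i (x + (Q i).[d] - (Q b).[d]).
pose G x := mean (fun d => Fd d x).
have Fd1 d x : nm (Fd d x) <= 1 by apply: nm_prod_le1 => i _.
have G1 x : nm (G x) <= 1 by apply: (nm_mean_le1 (Fp_gt0 p)).
have Ab : (#|A :\ b| <= m)%N by move: Am; rewrite (cardsD1 b) bA.
have LamG g : LamI Q (setf f b g) = mean (fun x => g x * G x).
  rewrite (LamI_dual _ _ b); apply: eq_mean => x; rewrite {1}/setf eqxx; congr (_ * _).
  by apply: eq_mean => d; apply: eq_bigr => i; rewrite /setf => /negPf->.
have sqr_le z : nm z <= Num.sqrt tau -> nm z ^+ 2 <= tau.
  by move=> zt; rewrite -(sqr_sqrtr (ltW t0)) lerXn2r ?nnegrE ?nm_ge0 ?sqrtr_ge0.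
have UG : U s G <= e.
  apply: (Htau p chi Fd) => //.
    move=> l eta eta0; apply: sqr_le.
    pose f' i y := bx l (fun r => f i (y - \sum_(z <- r) z)).
    have -> : mean (fun x => mean (fun d =>
        bx l (fun r => Fd d (x - \sum_(y <- r) y)) * chi (eta * x))) =
        LamI Q (setf f' b (fun x => chi (eta * x))).
      rewrite (LamI_dual _ _ b); apply: eq_mean => x; rewrite {1}/setf eqxx [RHS]mulrC -[RHS]meanMr.
      apply: eq_mean => d; congr (_ * _); rewrite bx_prod.
      apply: eq_bigr => i; rewrite /setf => /negPf->; rewrite /f'.
      by congr bx; apply: funext => r; congr (f i _); ring.
    have prod0 : \prod_i mean (setf f' b (fun x => chi (eta * x)) i) = 0.
      by rewrite (bigD1 b)//= {1}/setf eqxx (mean_chi chiP) (negPf eta0) mul0r.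
    rewrite -[LamI _ _]subr0 -prod0.
    apply: (Hp1 p pp p1p chi Q _ (A :\ b)) => //.
    + by apply: setf_le1 => [i x|x]; [apply: bx_le1|rewrite (nm_chi chiP)].
    + move=> i; rewrite !inE negb_and negbK /setf; case: eqP => [_ _|_ /= iA].
        by exists 1, eta; split=> [|x]; rewrite ?nm1 ?mul1r.
      by apply: bx_pseudochar => //; apply: Aps.
  rewrite -[U 0 _]/(nm (mean G) ^+ 2); apply: sqr_le.
  have -> : mean G = LamI Q (setf f b (fun _ => 1)).
    by rewrite LamG; apply: eq_mean => x; rewrite mul1r.
  have prod0 : \prod_i mean (setf f b (fun _ => 1) i) = 0.
    by rewrite (bigD1 a)//= {1}/setf (negPf ab) fa0 mul0r.
  rewrite -[LamI _ _]subr0 -prod0.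
  apply: (Hp1 p pp p1p chi Q _ (A :\ b)) => //.
  - by apply: setf_le1 => // x; rewrite nm1.
  - move=> i; rewrite !inE negb_and negbK /setf; case: eqP => [_ _|_ /= iA].
      by apply: pseudochar_cst => //; rewrite nm1.
    exact: Aps.
pose Gc x := (G x)^*.
have UGc : U s Gc = U s G.
  have DG h x : Dls h Gc x = (Dls h G x)^*.
    by elim: h x => //= h l IH x; rewrite /Dl conjM !IH.
  rewrite !U_Es; apply: eq_Es => h _; congr (_ ^+ 2); rewrite -[RHS]nm_conj conj_mean.
  by congr nm; apply: eq_mean => x; rewrite DG.
pose v := mean (fun x => nm (G x) ^+ 2).
have v0 : 0 <= v by apply: mean_ge0 => x; apply: sqr_ge0.
have vE : real_complex R v = LamI Q (setf f b Gc).
  by rewrite LamG rc_mean; apply: eq_mean => x; rewrite -mul_conj mulrC.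
have step : nm (LamI Q f) ^+ 2 <= v.
  rewrite (LamI_dual _ _ b); exact: (nm_mean_sqr G (Fp_gt0 p) (f1 b)).
have := HN p pp Dp Q (setf f b Gc) a b indQ sQ.
have b1 : forall i x, nm (setf f b Gc i x) <= 1.
  by apply: setf_le1 => // x; rewrite nm_conj.
move=> /(_ b1 ab); rewrite -vE nm_rc (ger0_norm v0) {1}/setf eqxx UGc => vN.
have ip : p%:R^-1 <= e.
  rewrite invf_ple ?posrE ?ltr0n ?prime_gt0//; apply: ltW.
  apply: lt_le_trans (archi_boundP _) _; first by rewrite invr_ge0 ltW.
  by rewrite ler_nat.
have N0 : (0 < N)%N.
  by rewrite lt0n; apply/eqP => N0; move: vN; rewrite N0 expr0 mul0r ler10.
have vd : v ^+ N <= (delta ^+ 2) ^+ N.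
  apply: le_trans vN _; rewrite -exprM.
  apply: (@le_trans _ _ (N%:R * (e + e))).
    by rewrite ler_wpM2l ?ler0n// lerD.
  have -> : e + e = delta ^+ (2 * N) / N.+1%:R.
    have two : (2^-1 : R) + 2^-1 = 1 by lra.
    by rewrite /e invfM [2^-1 * _]mulrC !mulrA -mulrDr two mulr1.
  rewrite mulrCA ler_piMr//; first by rewrite exprn_ge0 ?ltW.
  by rewrite ler_pdivrMr ?ltr0Sn// mul1r ler_nat.
have vd2 : v <= delta ^+ 2 by move: vd; rewrite ler_pXn2r// nnegrE// exprn_ge0 ?ltW.
have := le_trans step vd2.
by rewrite ler_pXn2r// nnegrE ?nm_ge0// ltW.
Qed.

Lemma claimS n D m : claim n D m -> (0 < m)%N -> claim n D m.+1.
Proof.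
move=> Hm m0 delta d0; have d4 : 0 < delta / 4 by rewrite divr_gt0.
have d2 : 0 < delta / 2 by rewrite divr_gt0.
have [p1 Hp1] := dual_small Hm d4; have [p2 Hp2] := Hm _ d2.
exists (maxn p1 p2) => p pp; rewrite geq_max => /andP[p1p p2p].
move=> chi Q f A chiP indQ sQ f1 Am Aps.
have [A1|A2] := leqP #|A| m.
  by apply: le_trans (Hp2 p pp p2p chi Q f A _ _ _ _ _ _) _ => //; lra.
have [a aA] : exists a, a \in A by apply/set0Pn; rewrite -card_gt0 (leq_trans _ A2).
have [b] : exists b, b \in A :\ a.
  apply/set0Pn; rewrite -card_gt0.
  by move: A2; rewrite (cardsD1 a) aA add1n ltnS; apply: leq_trans.
rewrite !inE => /andP[ba bA].
pose c := mean (f a).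
have c1 : nm c <= 1 by apply: (nm_mean_le1 (Fp_gt0 p)).
(* [f a] is the constant [c], a pseudocharacter, plus twice [g], which has mean zero. Halving keeps
   [g] bounded by 1, and the factor 2 explains [delta / 4]. *)
pose g x := 2^-1 * (f a x - c).
have nm2 : nm (2^-1 : C) = 2^-1.
  have -> : (2^-1 : C) = real_complex R 2^-1 by rewrite fmorphV rmorph_nat.
  by rewrite nm_rc ger0_norm ?invr_ge0.
have g1 x : nm (g x) <= 1.
  rewrite /g nmM nm2; have := nmB (f a x) c; have := f1 a x; lra.
have g0 : mean (setf f a g a) = 0.
  by rewrite /setf eqxx meanMl meanB (mean_cst (Fp_gt0 p)) subrr mulr0.
have decomp : LamI Q f =
    LamI Q (setf f a (fun _ => c)) + 2 * LamI Q (setf f a g).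
  rewrite -LamI_linear; apply: eq_LamI => i x; rewrite /setf.
  case: eqP => // ->; rewrite /g mulrA divff ?mul1r ?pnatr_eq0//.
  by rewrite addrC subrK.
have meanE : \prod_i mean (f i) = \prod_i mean (setf f a (fun _ => c) i).
  apply: eq_bigr => i _; rewrite /setf; case: eqP => // ->.
  by rewrite (mean_cst (Fp_gt0 p)).
rewrite decomp meanE addrAC.
apply: le_trans (nmD _ _) _.
have h1 : nm (LamI Q (setf f a (fun=> c)) - \prod_i mean (setf f a (fun=> c) i)) <= delta / 2.
  apply: (Hp2 p pp p2p chi Q _ (A :\ a)) => //.
  - exact: setf_le1.
  - by move: Am; rewrite (cardsD1 a) aA.
  - move=> i; rewrite !inE negb_and negbK /setf; case: eqP => [_ _|_ /= iA].
      exact: pseudochar_cst.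
    exact: Aps.
have h2 : nm (LamI Q (setf f a g)) <= delta / 4.
  apply: (Hp1 p pp p1p chi Q _ A a b) => //; first exact: setf_le1.
    move=> i iA; rewrite /setf; case: eqP => [ia|_]; last exact: Aps.
    by rewrite ia aA in iA.
  by rewrite eq_sym.
have h3 : nm (2 : C) = 2.
  have -> : (2 : C) = real_complex R 2 by rewrite rmorph_nat.
  by rewrite nm_rc ger0_norm.
rewrite nmM h3; lra.
Qed.

End Claim.

Lemma poly_indep (R : realType) (n D : nat) (delta : R) : 0 < delta ->
  exists p0 : nat, forall p, prime p -> (p0 <= p)%N ->
  forall (Q : 'I_n -> {poly 'F_p}) (f : 'I_n -> 'F_p -> R[i]),
  aff_indep Q -> (forall i, (size (Q i) <= D.+1)%N) ->
  (forall i x, nm (f i x) <= 1) ->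
  nm (LamI Q f - \prod_i mean (f i)) <= delta.
Proof.
move=> d0; have H m : claim R n D m.+1.
  by elim: m => [|m IH]; [exact: claim1|exact: claimS].
have [p0 Hp0] := H n delta d0; exists p0 => p pp pp0 Q f indQ sQ f1.
have [chi chiP] := chi_exists R p.
apply: (Hp0 p pp pp0 chi Q f [set: 'I_n]) => //.
  by rewrite cardsT card_ord.
by move=> i; rewrite inE.
Qed.

(** * Moments of the pattern counts *)

(** The function [g0] is given the extra polynomial 0; independence of the [Q i] modulo constants
    becomes affine independence of the enlarged family. *)
Lemma poly_indep_real (R : realType) (k D : nat) (delta : R) : 0 < delta ->
  exists p0 : nat, forall p, prime p -> (p0 <= p)%N ->
  forall (Q : 'I_k -> {poly 'F_p}) (g0 : 'F_p -> R) (g : 'I_k -> 'F_p -> R),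
  (forall c : 'I_k -> 'F_p, (size (\sum_i c i *: Q i)%R <= 1)%N -> forall i, c i = 0) ->
  (forall i, (size (Q i) <= D.+1)%N) ->
  (forall x, `|g0 x| <= 1) -> (forall i x, `|g i x| <= 1) ->
  `|mean (fun d => mean (fun x => g0 x * \prod_i g i (x + (Q i).[d])))
    - mean g0 * \prod_i mean (g i)| <= delta.
Proof.
move=> d0; have [p0 Hp0] := @poly_indep R k.+1 D delta d0.
exists p0 => p pp pp0 Q g0 g indQ sQ g01 g1.
pose Q' i := if unlift ord0 i is Some j then Q j else 0.
pose f i x := real_complex R (if unlift ord0 i is Some j then g j x else g0 x).
have f0 x : f ord0 x = real_complex R (g0 x) by rewrite /f unlift_none.
have fS j x : f (lift ord0 j) x = real_complex R (g j x) by rewrite /f liftK.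
have Q0 : Q' ord0 = 0 by rewrite /Q' unlift_none.
have QS j : Q' (lift ord0 j) = Q j by rewrite /Q' liftK.
have := Hp0 p pp pp0 Q' f.
have -> : LamI Q' f = real_complex R
    (mean (fun d => mean (fun x => g0 x * \prod_i g i (x + (Q i).[d])))).
  rewrite rc_mean /LamI [LHS]mean_exchange; apply: eq_mean => d.
  rewrite rc_mean; apply: eq_mean => x.
  rewrite big_ord_recl rmorphM rmorph_prod Q0 horner0 addr0 f0; congr (_ * _).
  by apply: eq_bigr => i _; rewrite fS QS.
have -> : \prod_i mean (f i) = real_complex R (mean g0 * \prod_i mean (g i)).
  rewrite big_ord_recl rmorphM rmorph_prod /= rc_mean; congr (_ * _).
    exact: eq_mean.
  by apply: eq_bigr => i _; rewrite rc_mean; apply: eq_mean => x.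
rewrite -rmorphB nm_rc; apply.
- move=> c c0 sc i.
  have ci j : c (lift ord0 j) = 0.
    apply: (indQ (fun j => c (lift ord0 j))).
    suff <- : \sum_i c i *: Q' i = \sum_j c (lift ord0 j) *: Q j by [].
    rewrite big_ord_recl Q0 scaler0 add0r.
    by apply: eq_bigr => j' _; rewrite QS.
  have c00 : c ord0 = 0 by move: c0; rewrite big_ord_recl big1 ?addr0.
  by case: (unliftP ord0 i) => [j ->|->].
- move=> i; case: (unliftP ord0 i) => [j ->|->]; rewrite ?QS ?Q0 ?size_poly0//.
- move=> i x; case: (unliftP ord0 i) => [j ->|->]; by rewrite ?fS ?f0 nm_rc.
Qed.

Lemma Es_prod (K : numFieldType) (p k : nat) (h : 'I_k -> 'F_p -> K) :
  Es k (fun r => \prod_i h i (nth 0 r i)) = \prod_i mean (h i).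
Proof.
elim: k h => [|k IH] h /=; first by rewrite !big_ord0.
rewrite big_ord_recl -IH -meanMr; apply: eq_mean => a.
rewrite -EsMl; apply: eq_Es => s _.
by rewrite big_ord_recl.
Qed.

Section Counts.
Variables (R : realType) (p k : nat) (A : {set 'F_p}).
Local Notation F := 'F_p.

Definition cor (g0 : F -> R) (g : 'I_k -> F -> R) (r : seq F) : R :=
  mean (fun x => g0 x * \prod_i g i (x + nth 0 r i)).

Definition cnt (w : 'I_k -> bool) : seq F -> R :=
  cor (ind R A) (fun i x => ind R A x ^+ w i).

Lemma Es_cor g0 g : Es k (cor g0 g) = mean g0 * \prod_i mean (g i).
Proof.
rewrite -Es_mean -meanMr; apply: eq_mean => x; rewrite EsMl; congr (_ * _).
rewrite (Es_prod (fun i y => g i (x + y))).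
by apply: eq_bigr => i _; rewrite mean_shiftl.
Qed.

(** Writing the second variable as [x + h] merges two correlations at the same shifts into one, with
    weights depending on [h]. *)
Lemma cor_cnt g0 g w r : cor g0 g r * cnt w r =
  mean (fun h => cor (fun x => g0 x * ind R A (x + h))
                     (fun i x => g i x * ind R A (x + h) ^+ w i) r).
Proof.
rewrite -meanMr mean_exchange; apply: eq_mean => x.
rewrite -meanMl -[LHS](mean_shiftl _ x); apply: eq_mean => h.
rewrite big_split /= mulrACA; congr (_ * (_ * _)).
by apply: eq_bigr => i _; rewrite addrAC.
Qed.

Lemma ind_01 x : 0 <= ind R A x <= 1.
Proof. by rewrite /ind; case: (x \in A); rewrite ?lexx ler01. Qed.

Lemma cnt_01 w r : 0 <= cnt w r <= 1.
Proof.
have P01 x : 0 <= \prod_(i < k) (ind R A (x + nth 0 r i) ^+ w i) <= 1.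
  have e01 (i : 'I_k) : 0 <= ind R A (x + nth 0 r i) ^+ w i <= 1.
    by case: (w i); rewrite ?expr1 ?ind_01// expr0 ler01 lexx.
  by rewrite prodr_ge0 ?prodr_ile1// => i _; case/andP: (e01 i).
apply/andP; split.
  apply: mean_ge0 => x; have /andP[i0 _] := ind_01 x.
  by have /andP[q0 _] := P01 x; rewrite mulr_ge0.
apply: (mean_le_cst (Fp_gt0 p)) => x /=; rewrite -[leRHS]mulr1.
by have /andP[i0 i1] := ind_01 x; have /andP[q0 q1] := P01 x; rewrite ler_pM.
Qed.

Variables (Q : 'I_k -> {poly F}) (delta : R).
Hypothesis QE : forall g0 g, (forall x, `|g0 x| <= 1) -> (forall i x, `|g i x| <= 1) ->
  `|mean (fun d => mean (fun x => g0 x * \prod_i g i (x + (Q i).[d])))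
    - mean g0 * \prod_i mean (g i)| <= delta.

Definition polyval d : seq F := [seq (Q i).[d] | i <- enum 'I_k].

Lemma nth_polyval d (i : 'I_k) : nth 0 (polyval d) i = (Q i).[d].
Proof. by rewrite (nth_map i) ?nth_ord_enum// size_enum_ord. Qed.

(** Each count is absorbed into [g0] and [g] by [cor_cnt], so the induction ranges over arbitrary
    bounded weights; the mean over [h] does not increase the error. *)
Lemma moments (L : seq ('I_k -> bool)) g0 g :
  (forall x, `|g0 x| <= 1) -> (forall i x, `|g i x| <= 1) ->
  `|mean (fun d => cor g0 g (polyval d) * \prod_(w <- L) cnt w (polyval d))
    - Es k (fun r => cor g0 g r * \prod_(w <- L) cnt w r)| <= delta.
Proof.
elim: L g0 g => [|w L IH] g0 g g01 g1.
  under eq_mean do rewrite big_nil mulr1.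
  under [X in Es k X]funext do rewrite big_nil mulr1.
  rewrite Es_cor; apply: le_trans (QE g01 g1); rewrite le_eqVlt; apply/orP; left.
  apply/eqP; congr (`|_ - _|); apply: eq_mean => d; apply: eq_mean => x.
  by congr (_ * _); apply: eq_bigr => i _; rewrite nth_polyval.
pose g0' h x := g0 x * ind R A (x + h).
pose g' h i x := g i x * ind R A (x + h) ^+ w i.
have E r : cor g0 g r * \prod_(w <- w :: L) cnt w r =
    mean (fun h => cor (g0' h) (g' h) r * \prod_(w <- L) cnt w r).
  by rewrite big_cons mulrA cor_cnt meanMr.
under eq_mean do rewrite E.
rewrite (eq_Es (g := fun r => mean (fun h => cor (g0' h) (g' h) r * \prod_(w <- L) cnt w r)));
  last by move=> r _; rewrite E.
rewrite mean_exchange -Es_mean -meanB.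
apply: (@le_trans _ _ (mean (fun h : F => delta))); last by rewrite (mean_cst (Fp_gt0 p)).
rewrite /mean normrM ger0_norm ?invr_ge0// ler_wpM2l ?invr_ge0//.
apply: le_trans (ler_norm_sum _ _ _) _; apply: ler_sum => h _.
have i1 x : `|ind R A x| <= 1.
  by have /andP[i0 i1] := ind_01 x; rewrite ger0_norm.
apply: IH.
  by move=> x; rewrite normrM -[1]mulr1 ler_pM.
move=> i x; rewrite normrM -[1]mulr1 ler_pM//.
by case: (w i); rewrite ?expr1// expr0 normr1.
Qed.

(* [C] bounds the coefficients, which makes [cntpoly_matching] uniform in [p]
   and [A]. *)
Definition cntpoly (C : R) (X : seq F -> R) : Prop :=
  exists l : seq (R * seq ('I_k -> bool)), \sum_(a <- l) `|a.1| <= C /\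
    forall r, X r = \sum_(a <- l) a.1 * \prod_(w <- a.2) cnt w r.

Lemma cntpoly_matching C X : 0 <= delta -> cntpoly C X ->
  `|mean (fun d => X (polyval d)) - Es k X| <= C * delta.
Proof.
move=> d0 [l [lC XE]].
have m1 L : `|mean (fun d => \prod_(w <- L) cnt w (polyval d))
    - Es k (fun r => \prod_(w <- L) cnt w r)| <= delta.
  have c1 r : cor (fun _ => 1) (fun _ _ => 1) r = 1.
    rewrite /cor (eq_mean (g := fun _ => 1)) ?(mean_cst (Fp_gt0 p))// => x.
    by rewrite big1 ?mulr1.
  have := @moments L (fun _ => 1) (fun _ _ => 1).
  under eq_mean do rewrite c1 mul1r.
  under [X in Es k X]funext do rewrite c1 mul1r.
  by apply; rewrite ?normr1.
have -> : X = fun r => \sum_(a <- l) a.1 * \prod_(w <- a.2) cnt w r by apply: funext.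
have -> : Es k (fun r => \sum_(a <- l) a.1 * \prod_(w <- a.2) cnt w r) =
    \sum_(a <- l) a.1 * Es k (fun r => \prod_(w <- a.2) cnt w r).
  elim: l {lC XE} => [|a l IH].
    under [X in Es k X]funext do rewrite big_nil.
    by rewrite big_nil (Es_cst (Fp_gt0 p)).
  under [X in Es k X]funext do rewrite big_cons.
  by rewrite big_cons EsD EsMl IH.
rewrite mean_sum -sumrB; apply: le_trans (ler_norm_sum _ _ _) _.
apply: (@le_trans _ _ (\sum_(a <- l) `|a.1| * delta)); last first.
  by rewrite -mulr_suml ler_wpM2r.
by apply: ler_sum => a _; rewrite meanMl -mulrBr normrM ler_wpM2l.
Qed.

Lemma cntpoly_cst a : cntpoly `|a| (fun _ => a).
Proof.
exists [:: (a, [::])]; rewrite big_seq1; split=> // r.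
by rewrite big_seq1 big_nil mulr1.
Qed.

Lemma cntpoly_cnt w : cntpoly 1 (cnt w).
Proof.
exists [:: (1, [:: w])]; rewrite big_seq1 normr1; split=> // r.
by rewrite !big_seq1 mul1r.
Qed.

Lemma cntpoly_le C C' X : cntpoly C X -> C <= C' -> cntpoly C' X.
Proof. by move=> [l [lC XE]] CC'; exists l; split=> //; apply: le_trans lC CC'. Qed.

Lemma cntpolyD C C' X Y : cntpoly C X -> cntpoly C' Y -> cntpoly (C + C') (fun r => X r + Y r).
Proof.
move=> [l [lC XE]] [l' [lC' YE]]; exists (l ++ l'); split=> [|r].
  by rewrite big_cat lerD.
by rewrite big_cat XE YE.
Qed.

Lemma cntpolyM C C' X Y : cntpoly C X -> cntpoly C' Y -> cntpoly (C * C') (fun r => X r * Y r).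
Proof.
move=> [l [lC XE]] [l' [lC' YE]].
exists [seq (a.1 * b.1, a.2 ++ b.2) | a <- l, b <- l']; split=> [|r].
  rewrite big_allpairs_dep.
  have -> : \sum_(a <- l) \sum_(b <- l') `|a.1 * b.1| =
    (\sum_(a <- l) `|a.1|) * (\sum_(b <- l') `|b.1|).
    rewrite mulr_suml; apply: eq_bigr => a _; rewrite mulr_sumr.
    by apply: eq_bigr => b _; rewrite normrM.
  by rewrite ler_pM// sumr_ge0.
rewrite big_allpairs_dep XE YE mulr_suml; apply: eq_bigr => a _.
by rewrite mulr_sumr; apply: eq_bigr => b _; rewrite /= big_cat mulrACA.
Qed.

Lemma cntpolyX C X n : cntpoly C X -> cntpoly (C ^+ n) (fun r => X r ^+ n).
Proof.
move=> CX; elim: n => [|n IH].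
  rewrite expr0 (_ : (fun r => _) = fun _ => 1); last by apply: funext => r; rewrite expr0.
  by have := cntpoly_cst 1; rewrite normr1.
rewrite exprS (_ : (fun r => _) = fun r => X r * X r ^+ n); first exact: cntpolyM.
by apply: funext => r; rewrite exprS.
Qed.

Lemma cntpolyN C X : cntpoly C X -> cntpoly C (fun r => - X r).
Proof.
move=> CX; rewrite (_ : (fun r => _) = fun r => -1 * X r).
  by rewrite -[C]mul1r; apply: cntpolyM => //; have := cntpoly_cst (-1); rewrite normrN1.
by apply: funext => r; rewrite mulN1r.
Qed.

Lemma cntpoly_prod (I : Type) (s : seq I) C (X : I -> seq F -> R) :
  (forall i, cntpoly C (X i)) -> cntpoly (C ^+ size s) (fun r => \prod_(i <- s) X i r).
Proof.
move=> CX; elim: s => [|i s IH].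
  rewrite expr0 (_ : (fun r => _) = fun _ => 1); last by apply: funext => r; rewrite big_nil.
  by have := cntpoly_cst 1; rewrite normr1.
rewrite exprS (_ : (fun r => _) = fun r => X i r * \prod_(i <- s) X i r).
  exact: cntpolyM.
by apply: funext => r; rewrite big_cons.
Qed.

End Counts.

(** * Threshold polynomials *)

Lemma bernoulli (R : realFieldType) (n : nat) (y : R) : -1 <= y ->
  1 + n%:R * y <= (1 + y) ^+ n.
Proof.
case: n => [|n] y1; first by rewrite mul0r addr0 expr0.
have y0 : 0 <= 1 + y by lra.
by have := tangent_pow n ler01 y0; rewrite !expr1n mulr1 addrAC subrr add0r.
Qed.

(** [K] is about the inverse of [b ^+ n]. Below [a], Bernoulli bounds the value by [K * x ^+ n], at
    most [2 * (a / b) ^+ n], which a large [n] brings below [eta]. Above [b], put [y = x ^+ n]: then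
    [K * y >= 1], and [(1 - y) ^+ K] is at most the inverse of [(1 + y) ^+ K], which is at least
    2. *)
Lemma threshold (R : realType) (a b eta : R) : 0 < a -> a < b -> b <= 1 -> 0 < eta ->
  exists n K : nat, forall x, 0 <= x <= 1 ->
  [/\ 0 <= 1 - (1 - x ^+ n) ^+ K <= 1,
      x <= a -> 1 - (1 - x ^+ n) ^+ K <= eta &
      b <= x -> 1 / 2 <= 1 - (1 - x ^+ n) ^+ K].
Proof.
move=> a0 ab b1 eta0; have b0 : 0 < b by lra.
pose t := b / a - 1.
have t0 : 0 < t by rewrite /t subr_gt0 ltr_pdivlMr// mul1r.
pose n := Num.bound (2 / eta / t).
have ratio : 2 * a ^+ n <= eta * b ^+ n.
  have : 2 / eta <= (b / a) ^+ n.
    have -> : b / a = 1 + t by rewrite /t addrC subrK.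
    apply: le_trans (bernoulli n _); last by lra.
    have : 2 / eta / t < n%:R by apply: archi_boundP; rewrite !divr_ge0// ltW.
    by rewrite ltr_pdivrMr// => h; apply: ltW; apply: lt_le_trans h _; rewrite lerDr.
  by rewrite expr_div_n ler_pdivrMr// mulrAC ler_pdivlMr ?exprn_gt0// [_ * eta]mulrC.
have bn0 : 0 < b ^+ n by rewrite exprn_gt0.
have bn1 : b ^+ n <= 1 by rewrite exprn_ile1// ltW.
pose K := (Num.truncn (b ^+ n)^-1).+1.
have [K1 K2] : 1 <= K%:R * b ^+ n /\ K%:R * b ^+ n <= 2.
  have /andP[l1 l2] : (Num.truncn (b ^+ n)^-1)%:R <= (b ^+ n)^-1 < K%:R.
    by apply: truncn_itv; rewrite invr_ge0 ltW.
  split; first by rewrite -ler_pdivrMr// mul1r ltW.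
  rewrite /K -natr1 mulrDl mul1r -[2]/(1 + 1) lerD//.
  by rewrite -ler_pdivlMr// mul1r.
exists n, K => x /andP[x0 x1].
have xn0 : 0 <= x ^+ n by rewrite exprn_ge0.
have xn1 : x ^+ n <= 1 by rewrite exprn_ile1.
have z0 : 0 <= (1 - x ^+ n) ^+ K by rewrite exprn_ge0// subr_ge0.
have z1 : (1 - x ^+ n) ^+ K <= 1 by rewrite exprn_ile1 ?subr_ge0// gerBl.
split; first by apply/andP; split; lra.
- move=> xa; have xan : x ^+ n <= a ^+ n by rewrite lerXn2r ?nnegrE// ltW.
  have : -1 <= - x ^+ n by lra.
  move=> /(bernoulli K) h.
  suff : K%:R * x ^+ n <= eta by lra.
  apply: (@le_trans _ _ (K%:R * a ^+ n)); first by rewrite ler_wpM2l.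
  rewrite -(ler_pM2r bn0) mulrAC; apply: le_trans ratio.
  by rewrite ler_wpM2r// exprn_ge0// ltW.
- move=> bx; have bxn : b ^+ n <= x ^+ n by rewrite lerXn2r ?nnegrE ?(ltW b0).
  have : -1 <= x ^+ n by lra.
  move=> /(bernoulli K) h.
  have h2 : (1 - x ^+ n) ^+ K * (1 + x ^+ n) ^+ K <= 1.
    rewrite -exprMn exprn_ile1//; nra.
  have h3 : 1 <= K%:R * x ^+ n by apply: le_trans K1 _; rewrite ler_wpM2l.
  nra.
Qed.

(** * Ramsey's theorem *)

Fixpoint prehom (T : eqType) (m : nat) (col : pred (seq T)) (Y : seq T) : Prop :=
  if Y is x :: Y' then
    (exists c, forall u, subseq u Y' -> size u = m -> col (x :: u) = c) /\ prehom m col Y'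
  else True.

Lemma prehom_split (T : eqType) m (col : pred (seq T)) (Y : seq T) : prehom m col Y ->
  exists Z : bool -> seq T, (size (Z true) + size (Z false) = size Y)%N /\
  forall c, subseq (Z c) Y /\
    forall u, subseq u (Z c) -> size u = m.+1 -> col u = c.
Proof.
elim: Y => [_|x Y IH [[c Hc] /IH[Z [sZ HZ]]]].
  exists (fun _ => [::]); split=> // c; split=> // u.
  by rewrite subseq0 => /eqP->.
exists (fun c' => if c' == c then x :: Z c' else Z c'); split.
  by rewrite /= -sZ; case: c {Hc} => /=; rewrite ?addnS.
move=> c'; have [ZY Zc'] := HZ c'; case: eqP => [cc'|_]; last first.
  by split=> //; apply: subseq_trans ZY (subseq_cons _ _).
split=> [|[|y u]]; first by rewrite /= eqxx.
  by [].
rewrite [subseq _ _]/=; case: eqP => [->|_] uZ su; last exact: Zc'.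
rewrite cc'; apply: Hc; last by case: su.
exact: subseq_trans uZ ZY.
Qed.

(** Induction on the length [m]: for one first entry [x] after another, the colouring
    [u |-> col (x :: u)] is made constant on a long remainder; pigeonhole over the two colours of
    first entries then needs length [M + M]. The bound serves all types, hence all [p]. *)
Lemma ramsey (m M : nat) : exists N, forall (T : eqType) (col : pred (seq T)) (X : seq T),
  (N <= size X)%N -> exists Y, [/\ subseq Y X, size Y = M &
    exists c, forall u, subseq u Y -> size u = m -> col u = c].
Proof.
elim: m M => [|m IH] M.
  exists M => T col X MX; exists (take M X); split; first exact: take_subseq.
    by rewrite size_takel.
  by exists (col [::]) => u _ /size0nil->.
have pre L : exists N, forall (T : eqType) (col : pred (seq T)) (X : seq T),
    (N <= size X)%N -> exists Y, [/\ subseq Y X, size Y = L & prehom m col Y].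
  elim: L => [|L [NL HL]]; first by exists 0%N => T col X _; exists [::]; rewrite sub0seq.
  have [N HN] := IH NL; exists N.+1 => T col [//|x X]; rewrite ltnS => NX.
  have [Y [YX sY [c Hc]]] := HN T (fun u => col (x :: u)) X NX.
  have [Y' [Y'Y sY' pY']] := HL T col Y (eq_leq (esym sY)).
  exists (x :: Y'); split; [|by rewrite /= sY'|split=> //].
    by rewrite /= eqxx (subseq_trans Y'Y).
  by exists c => u uY' su; apply: Hc => //; apply: subseq_trans uY' Y'Y.
have [N HN] := pre (M + M)%N; exists N => T col X NX.
have [Y [YX sY /prehom_split[Z [sZ HZ]]]] := HN T col X NX.
have [c Mc] : exists c, (M <= size (Z c))%N.
  have [h|h] := leqP M (size (Z true)); first by exists true.
  exists false; rewrite -(leq_add2l M) -sY -sZ leq_add2r; exact: ltnW.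
have [ZY Hc] := HZ c.
exists (take M (Z c)); split.
- exact: subseq_trans (take_subseq _ _) (subseq_trans ZY YX).
- by rewrite size_takel.
- by exists c => u uZ; apply: Hc; apply: subseq_trans uZ (take_subseq _ _).
Qed.

(** * Positive density of good shifts *)

Section Shifts.
Variables (R : realType) (p : nat) (A : {set 'F_p}).
Local Notation F := 'F_p.

Definition scor (V : seq F) : R := mean (fun x => \prod_(v <- V) ind R A (x + v)).

Definition dens : R := mean (ind R A).

Lemma dens_01 : 0 <= dens <= 1.
Proof.
apply/andP; split; first by apply: mean_ge0 => x; case/andP: (ind_01 R A x).
by apply: (mean_le_cst (Fp_gt0 p)) => x; case/andP: (ind_01 R A x).
Qed.

Lemma dens_pow_01 n : 0 <= dens ^+ n <= 1.
Proof. by have /andP[d0 d1] := dens_01; rewrite exprn_ge0 ?exprn_ile1. Qed.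

(** For each [x], the sets [V] with product 1 are the [m]-subsets of the positions whose shifts hit
    [A]. Positions are used because [Y] may repeat a shift. *)
Lemma sum_scor (M m : nat) (Y : seq F) :
  \sum_(V : {set 'I_M} | #|V| == m) scor [seq nth 0 Y (i : 'I_M) | i <- enum V] =
  mean (fun x => 'C(#|[set i : 'I_M | x + nth 0 Y i \in A]|, m)%:R).
Proof.
rewrite -mean_sum; apply: eq_mean => x.
set D := [set i : 'I_M | x + nth 0 Y i \in A].
rewrite -cards_draws -sum1_card natr_sum big_mkcond [RHS]big_mkcond.
apply: eq_bigr => V _; rewrite inE andbC; case: (#|V| == m) => //=.
rewrite big_map big_enum /= /ind.
have [/subsetP VA|/subsetPn[i iV iA]] := boolP (V \subset D).
  by rewrite big1// => i /VA; rewrite /D inE => ->.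
by rewrite (bigD1 i)//=; move: iA; rewrite /D inE => /negPf->; rewrite mul0r.
Qed.

End Shifts.

Lemma expn_sub_le_ffact n m : ((n - m) ^ m <= n ^_ m)%N.
Proof.
suff H j : (j <= m)%N -> ((n - m) ^ j <= n ^_ j)%N by exact: H.
elim: j => // j IH jm; rewrite expnSr ffactnSr leq_mul ?IH ?(ltnW jm)//.
by rewrite leq_sub2l// ltnW.
Qed.

Lemma ffact_le_expn n m : (n ^_ m <= n ^ m)%N.
Proof. by elim: m => // m IH; rewrite expnSr ffactnSr leq_mul ?leq_subr. Qed.

(* Averaging [binomial(S(x), m)], where [S(x)] counts the [t] in [Y] with
   [x + t] in [A], shows that some [m]-element subsequence has a large
   correlation. *)
Lemma scor_large (R : realType) (m : nat) (eps : R) : 0 < eps ->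
  exists M, forall p (A : {set 'F_p}) (Y : seq 'F_p), size Y = M ->
  exists u, [/\ subseq u Y, size u = m & dens R A ^+ m - eps <= scor R A u].
Proof.
move=> e0; case: m => [|m].
  exists 0%N => p A Y _; exists [::]; split=> //; first by rewrite sub0seq.
  rewrite expr0 /scor (eq_mean (g := fun _ => 1)); last by move=> x; rewrite big_nil.
  by rewrite (mean_cst (Fp_gt0 p)) gerBl ltW.
(* Replacing [S x] by [S x - m.+1] lowers the mean density by at most [m.+1 / M], and the tangent
   line has slope at most [m.+1]; the product must not exceed [eps]. *)
pose M := maxn m.+1 (Num.bound ((m.+1 ^ 2)%:R / eps)).
exists M => p A Y sY; apply: contrapT => nex.
have small u : subseq u Y -> size u = m.+1 -> scor R A u < dens R A ^+ m.+1 - eps.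
  by move=> uY su; rewrite ltNge; apply/negP => le_u; apply: nex; exists u.
have mM : (m.+1 <= M)%N by rewrite leq_maxl.
have M0 : 0 < M%:R :> R by rewrite ltr0n (leq_trans _ mM).
have Mb : (m.+1 ^ 2)%:R / M%:R <= eps.
  rewrite ler_pdivrMr// mulrC -ler_pdivrMr// ltW//.
  apply: lt_le_trans (archi_boundP _) _; first by rewrite divr_ge0// ltW.
  by rewrite ler_nat leq_maxr.
set al := dens R A; pose S x := #|[set i : 'I_M | x + nth 0 Y i \in A]|.
have [al0 al1] := andP (dens_01 R A).
have up : mean (fun x => 'C(S x, m.+1)%:R) < 'C(M, m.+1)%:R * (al ^+ m.+1 - eps).
  rewrite -sum_scor.
  have -> : 'C(M, m.+1)%:R * (al ^+ m.+1 - eps) =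
      \sum_(V : {set 'I_M} | #|V| == m.+1) (al ^+ m.+1 - eps).
    rewrite -[X in 'C(X, _)]card_ord -cardsT -cards_draws -sum1_card natr_sum.
    rewrite mulr_suml big_mkcond [RHS]big_mkcond; apply: eq_bigr => V _.
    by rewrite inE subsetT /=; case: ifP => // _; rewrite mul1r.
  have [V0 sV0] : exists V : {set 'I_M}, #|V| == m.+1.
    suff : (0 < #|[set V : {set 'I_M} | V \subset setT & #|V| == m.+1]|)%N.
      by case/card_gt0P => V; rewrite inE => /andP[_ ?]; exists V.
    by rewrite cards_draws cardsT card_ord bin_gt0.
  have lt_V (V : {set 'I_M}) : #|V| == m.+1 ->
      scor R A [seq nth 0 Y (i : 'I_M) | i <- enum V] < al ^+ m.+1 - eps.
    move=> /eqP sV; apply: small; last by rewrite size_map -cardE.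
    have {2}-> : Y = [seq nth 0 Y (i : 'I_M) | i <- enum 'I_M].
      rewrite (map_comp (nth 0 Y) val) val_enum_ord -sY.
      by rewrite -[LHS](mkseq_nth 0).
    apply: map_subseq; rewrite enumT; exact: filter_subseq.
  rewrite (bigD1 V0)//= [ltRHS](bigD1 V0)//= ltr_leD ?lt_V// ler_sum// => V /andP[sV _].
  exact/ltW/lt_V.
pose y x : R := (S x - m.+1)%:R / M%:R.
have y0 x : 0 <= y x by rewrite divr_ge0.
have meanS : mean (fun x => (S x)%:R) = M%:R * al.
  have E x : (S x)%:R = \sum_(i < M) ind R A (x + nth 0 Y i).
    rewrite /S -sum1_card natr_sum big_mkcond; apply: eq_bigr => i _.
    by rewrite inE /ind; case: (_ \in A).
  under eq_mean do rewrite E.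
  rewrite mean_sum; under eq_bigr do rewrite mean_shift.
  by rewrite sumr_const card_ord mulr_natl.
have meany : al - m.+1%:R / M%:R <= mean y.
  have -> : al = mean (fun x => (S x)%:R / M%:R).
    by rewrite meanMr meanS mulrAC divff ?mul1r// gt_eqF.
  rewrite -[X in _ - X](mean_cst (Fp_gt0 p)) -meanB; apply: ler_mean => x.
  rewrite -mulrBl ler_wpM2r ?invr_ge0 ?(ltW M0)//.
  have [Sm|Sm] := leqP (S x) m.+1.
    have -> : (S x - m.+1 = 0)%N by apply/eqP.
    by rewrite mulr0n subr_le0 ler_nat.
  by rewrite natrB// ltnW.
have low : al ^+ m.+1 - eps <= mean (fun x => y x ^+ m.+1).
  apply: le_trans (ler_mean (fun x => tangent_pow m al0 (y0 x))).
  rewrite meanD (mean_cst (Fp_gt0 p)) meanMl meanB (mean_cst (Fp_gt0 p)) lerD2l.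
  have [am0 am1] := andP (dens_pow_01 R A m).
  rewrite -/al in am0 am1.
  apply: (@le_trans _ _ (m.+1%:R * al ^+ m * (- (m.+1%:R / M%:R)))); last first.
    apply: ler_wpM2l; first by rewrite mulr_ge0.
    by rewrite lerBrDl.
  rewrite mulrN lerN2; apply: le_trans Mb.
  rewrite natrX expr2 -!mulrA ler_wpM2l// ler_piMl//.
  by rewrite mulr_ge0// invr_ge0 ltW.
have bin_low x : M%:R ^+ m.+1 * y x ^+ m.+1 <= (m.+1)`!%:R * 'C(S x, m.+1)%:R.
  rewrite -exprMn /y mulrCA divff ?mulr1 ?gt_eqF// -natrX -natrM ler_nat.
  by rewrite mulnC bin_ffact expn_sub_le_ffact.
set q := al ^+ m.+1 - eps in up low.
pose fC : R := (m.+1)`!%:R * mean (fun x => 'C(S x, m.+1)%:R).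
have f0 : 0 < (m.+1)`!%:R :> R by rewrite ltr0n fact_gt0.
have lowC : M%:R ^+ m.+1 * q <= fC.
  rewrite /fC -meanMl; apply: le_trans (ler_mean bin_low).
  by rewrite meanMl ler_wpM2l// exprn_ge0// ltW.
have upC : fC < (M ^_ m.+1)%:R * q.
  by rewrite -bin_ffact mulnC natrM -mulrA ltr_pM2l.
have fC0 : 0 <= fC by rewrite mulr_ge0 ?(ltW f0)// mean_ge0.
(* For negative [q] the comparison of [M ^_ m.+1] with [M ^ m.+1] reverses; there [upC] contradicts
   [fC0] directly. *)
have [q0|q0] := leP 0 q.
  have : (M ^_ m.+1)%:R * q <= M%:R ^+ m.+1 * q.
    by rewrite ler_wpM2r// -natrX ler_nat ffact_le_expn.
  by move=> /(lt_le_trans upC) /(le_lt_trans lowC); rewrite ltxx.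
have : (M ^_ m.+1)%:R * q <= 0 by rewrite mulr_ge0_le0// ltW.
by move=> /(lt_le_trans upC) /(le_lt_trans fC0); rewrite ltxx.
Qed.

(* Ramsey's theorem, one size at a time, makes all short subsequences good at
   once. *)
Lemma good_subseq (R : realType) (eps : R) (m M : nat) : 0 < eps ->
  exists N, forall p (A : {set 'F_p}) (X : seq 'F_p), (N <= size X)%N ->
  exists Y, [/\ subseq Y X, size Y = M & forall u, subseq u Y -> (size u <= m)%N ->
    dens R A ^+ size u - eps <= scor R A u].
Proof.
move=> e0; elim: m M => [|m IH] M.
  exists M => p A X MX; exists (take M X); split.
  - exact: take_subseq.
  - by rewrite size_takel.
  - move=> u _; rewrite leqn0 size_eq0 => /eqP->.
    rewrite expr0 /scor (eq_mean (g := fun _ => 1)); last by move=> x; rewrite big_nil.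
    by rewrite (mean_cst (Fp_gt0 p)) gerBl ltW.
have [M1 HM1] := scor_large m.+1 e0.
have [N2 HN2] := ramsey m.+1 (maxn M M1); have [N HN] := IH N2.
exists N => p A X NX; have [Y [YX sY Ygood]] := HN p A X NX.
pose col (u : seq 'F_p) := dens R A ^+ size u - eps <= scor R A u.
have [Z [ZY sZ [c Hc]]] := HN2 _ col Y (eq_leq (esym sY)).
(* The first [M1] entries contain one good subsequence of length [m.+1], so the common colour is the
   good one. *)
have c1 : c = true.
  have [|u [uZ su le_u]] := HM1 p A (take M1 Z); first by rewrite size_takel// sZ leq_maxr.
  have := Hc u (subseq_trans uZ (take_subseq _ _)) su.
  by rewrite /col su le_u => <-.
exists (take M Z); split.
- exact: subseq_trans (take_subseq _ _) (subseq_trans ZY YX).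
- by rewrite size_takel// sZ leq_maxl.
- move=> u uZ; have {}uZ := subseq_trans uZ (take_subseq _ _).
  rewrite leq_eqVlt => /predU1P[su|]; last by rewrite ltnS; apply: Ygood (subseq_trans uZ ZY).
  by have := Hc u uZ su; rewrite /col c1.
Qed.

Lemma Es_sum (K : numFieldType) (T : finType) t (I : Type) (r : seq I) (P : pred I)
    (f : I -> seq T -> K) :
  Es t (fun s => \sum_(i <- r | P i) f i s) = \sum_(i <- r | P i) Es t (f i).
Proof.
by elim: t f => //= t IH f; rewrite -mean_sum; apply: eq_mean => a; rewrite IH.
Qed.

Lemma Es_mask (K : numFieldType) (T : finType) (b : bitseq) (q : seq T -> K) :
  (0 < #|T|)%N -> Es (size b) (fun X => q (mask b X)) = Es (count id b) q.
Proof.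
move=> T0; elim: b q => [|[] b IH] q //=; last by rewrite (mean_cst T0) IH.
by apply: eq_mean => a; rewrite (IH (fun s => q (a :: s))).
Qed.

Definition goodshift (R : realType) p (A : {set 'F_p}) (eps : R) (u : seq 'F_p) : bool :=
  `[< forall v, subseq v u -> dens R A ^+ size v - eps <= scor R A v >].

(** Every list of length [N] has a good sublist at one of [2 ^ N] masks, and the entries at a fixed
    mask of weight [k] are again uniform; so [k] random shifts are good with probability at least
    [1 / 2 ^ N]. *)
Lemma good_density (R : realType) (eps : R) (k : nat) : 0 < eps ->
  exists2 c : R, 0 < c & forall p (A : {set 'F_p}),
    c <= Es k (fun u => (goodshift A eps u)%:R).
Proof.
move=> e0; have [N HN] := good_subseq k k e0.
exists (2 ^+ N)^-1; first by rewrite invr_gt0 exprn_gt0.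
move=> p A; pose q (u : seq 'F_p) : R := (goodshift A eps u)%:R.
have N0 := Fp_gt0 p.
have le1 : 1 <= \sum_(b : N.-tuple bool | count id b == k) Es N (fun X => q (mask b X)).
  rewrite -Es_sum -[leLHS](Es_cst N0 N); apply: ler_Es => X sX.
  have [Y [/subseqP[b sb YE] sY Ygood]] := HN p A X (eq_leq (esym sX)).
  have sb' : size b == N by rewrite sb sX.
  have cb : count id (Tuple sb') == k by rewrite /= -(size_mask sb) -YE sY.
  rewrite (bigD1 (Tuple sb'))//= -YE.
  have -> : q Y = 1.
    rewrite /q /goodshift asboolT// => v vY; apply: Ygood => //.
    by rewrite -sY size_subseq.
  by rewrite lerDl sumr_ge0// => b' _; rewrite ler0n.
rewrite -div1r ler_pdivrMr ?exprn_gt0//; apply: le_trans le1 _.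
apply: (@le_trans _ _ (\sum_(b : N.-tuple bool) Es k q)).
  rewrite big_mkcond; apply: ler_sum => b _; case: eqP => [<-|_].
    by rewrite -(Es_mask b q N0) size_tuple.
  by apply: Es_ge0 => u; rewrite ler0n.
by rewrite sumr_const card_tuple card_bool -[_ *+ _]mulr_natr natrX.
Qed.

(** * Reduction modulo [p] and conclusion *)

Lemma avg_setT (R : realType) p (f : 'F_p -> R) : avg [set: 'F_p] f = mean f.
Proof. by rewrite /avg /mean cardsT; congr (_ * _); apply: eq_bigl => x; rewrite inE. Qed.

(** Translating [x] by [u0] turns the first of [k.+1] shifts into the unshifted factor of [cnt]; the
    pattern [w] selects the subsequence [v] of the others. *)
Lemma good_cnt (R : realType) p (A : {set 'F_p}) (eps : R) k u0 s (w : 'I_k -> bool) :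
  size s = k -> goodshift A eps (u0 :: s) ->
  dens R A ^+ (1 + \sum_(i < k) w i) - eps <= cnt R A w [seq x - u0 | x <- s].
Proof.
move=> sk /asboolP good.
pose I := [seq i <- enum 'I_k | w i].
pose v := [seq nth 0 s (i : 'I_k) | i <- I].
have sE : s = [seq nth 0 s (i : 'I_k) | i <- enum 'I_k].
  by rewrite (map_comp (nth 0 s) val) val_enum_ord -sk -[LHS](mkseq_nth 0).
have vs : subseq v s by rewrite [X in subseq _ X]sE map_subseq// filter_subseq.
have sv : size v = (\sum_(i < k) w i)%N.
  rewrite size_map -sum1_size big_filter big_enum_cond big_mkcond.
  by apply: eq_bigr => i _ /=; case: (w i).
have := good (u0 :: v); rewrite /= eqxx sv add1n => /(_ vs) h.
apply: le_trans h _; rewrite le_eqVlt; apply/orP; left; apply/eqP.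
rewrite /cnt /cor -[RHS](mean_shift _ u0); apply: eq_mean => x.
rewrite big_cons; congr (_ * _).
rewrite big_map big_filter big_enum_cond big_mkcond; apply: eq_bigr => i _ /=.
rewrite (nth_map 0) ?sk//; case: (w i); rewrite ?expr0// expr1.
by congr (ind R A _); ring.
Qed.

Lemma cnt_density (R : realType) (eps : R) (k : nat) : 0 < eps ->
  exists2 c : R, 0 < c & forall p (A : {set 'F_p}),
    c <= Es k (fun r => [forall w : {ffun 'I_k -> bool},
      dens R A ^+ (1 + \sum_(i < k) w i) - eps <= cnt R A w r]%:R).
Proof.
move=> e0; have [c c0 Hc] := good_density k.+1 e0; exists c => // p A.
apply: le_trans (Hc p A) _; rewrite /=.
apply: (mean_le_cst (Fp_gt0 p)) => u0; rewrite -[leRHS](Es_shift k (- u0)).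
apply: ler_Es => s sk; rewrite ler_nat.
have [good|//] := boolP (goodshift _ _ _).
rewrite lt0b; apply/forallP => w; exact: good_cnt.
Qed.

(** The rational coefficient matrix has a right inverse; clearing denominators gives an integer
    matrix [z] whose product with it is [nn] times the identity, and [nn] is invertible modulo
    [p > nn]. As the constant terms vanish, a relation modulo constants is a relation of all
    coefficients. *)
Lemma indep_mod (k : nat) (P : 'I_k -> {poly int}) :
  lin_indep P -> (forall i, (P i)`_0 = 0) ->
  exists p0 : nat, forall p, prime p -> (p0 <= p)%N ->
  forall c : 'I_k -> 'F_p,
    (size (\sum_i c i *: map_poly (intr : int -> 'F_p) (P i))%R <= 1)%N ->
    forall i, c i = 0.
Proof.
move=> indP P0; pose D := (\max_(i < k) size (P i))%N.
pose M : 'M[rat]_(k, D) := \matrix_(i, j) ((P i)`_j)%:~R.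
have /row_freeP[B MB] : row_free M.
  apply: inj_row_free => v vM; apply/rowP => i; rewrite mxE.
  apply: (indP (fun i => v 0 i)); apply/polyP => j; rewrite coef0 coef_sum.
  have [jD|Dj] := ltnP j D; last first.
    rewrite big1// => l _; rewrite coefZ coef_map nth_default ?mulr0//.
    by rewrite (leq_trans _ Dj)// (leq_bigmax l).
  have := congr1 (fun A : 'rV[rat]_D => A 0 (Ordinal jD)) vM; rewrite !mxE => E.
  rewrite -[RHS]E; apply: eq_bigr => l _; by rewrite coefZ coef_map !mxE.
pose nn : int := \prod_(q : 'I_D * 'I_k) denq (B q.1 q.2).
pose z (j : 'I_D) (l : 'I_k) : int :=
  numq (B j l) * \prod_(q : 'I_D * 'I_k | q != (j, l)) denq (B q.1 q.2).
have nn0 : 0 < nn by apply: prodr_gt0 => q _; apply: denq_gt0.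
have zE j l : (z j l)%:~R = nn%:~R * B j l :> rat.
  rewrite /nn (bigD1 (j, l))//= /z !intrM [RHS]mulrAC.
  by congr (_ * _); rewrite numqE mulrC.
have key i l : \sum_(j < D) (P i)`_j * z j l = nn * (i == l)%:R.
  apply: (@intr_inj rat); rewrite intrM raddf_sum /=.
  have := congr1 (fun A : 'M_k => A i l) MB; rewrite !mxE => e.
  have -> : ((i == l)%:R : int)%:~R = (i == l)%:R :> rat by case: eqP.
  rewrite -e mulr_sumr; apply: eq_bigr => j _.
  by rewrite intrM zE mxE mulrCA.
exists `|nn|.+1%N => p pp nnp c sc l.
have coef0 (j : nat) : \sum_i c i * ((P i)`_j)%:~R = 0.
  transitivity ((\sum_i c i *: map_poly (intr : int -> 'F_p) (P i))`_j).
    by rewrite coef_sum; apply: eq_bigr => i _; rewrite coefZ coef_map.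
  case: j => [|j].
    by rewrite coef_sum big1// => i _; rewrite coefZ coef_map P0 mulr0.
  by rewrite nth_default// (leq_trans sc).
have intr_sum (f : 'I_D -> int) : (\sum_j f j)%:~R = \sum_j (f j)%:~R :> 'F_p.
  by apply: big_morph => // x y; rewrite intrD.
have : c l * nn%:~R = 0.
  transitivity (\sum_(j < D) (\sum_i c i * ((P i)`_j)%:~R) * (z j l)%:~R).
    under eq_bigr do rewrite mulr_suml.
    rewrite exchange_big /= (bigD1 l)//= [X in _ + X]big1 ?addr0.
      transitivity (c l * (nn * (l == l)%:R)%:~R); first by rewrite eqxx mulr1.
      rewrite -key intr_sum mulr_sumr; apply: eq_bigr => j _.
      by rewrite [in LHS]intrM ?[RHS]mulrA ?mulrA.
    move=> i il; transitivity (c i * (nn * (i == l)%:R)%:~R).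
      rewrite -key intr_sum mulr_sumr; apply: eq_bigr => j _.
      by rewrite [in RHS]intrM [RHS]mulrA.
    by rewrite (negPf il) mulr0 mulr0z mulr0.
  by rewrite big1// => j _; rewrite coef0 mul0r.
move/eqP; rewrite mulf_eq0 => /orP[/eqP//|].
have -> : nn%:~R = `|nn|%N%:R :> 'F_p by rewrite -{1}(gtz0_abs nn0).
by rewrite (negPf (Fp_natr_neq0 pp _))// nnp absz_gt0 gt_eqF.
Qed.
Theorem theorem1p1 (R : realType) (k : nat) (hk : (1 <= k)%N)
    (P : 'I_k -> {poly int}) (hfree : lin_indep P)
    (hP0 : forall i, (P i)`_0 = 0) (eps : R) (heps : 0 < eps) :
  exists p0 : nat, forall p : nat, prime p -> (p0 <= p)%N ->
    forall A : {set 'F_p},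
      let alpha : R := avg [set: 'F_p] (ind R A) in
      exists d : 'F_p, d != 0 /\
        forall omega : 'I_k -> bool,
          alpha ^+ (1 + \sum_(i < k) omega i)%N - eps <=
          avg [set: 'F_p]
            (fun x => ind R A x *
               \prod_(i < k) ind R A (x + evalp (P i) d) ^+ omega i).
Proof.
(* The cap keeps the lower threshold [(1 - e) / 2] positive. *)
pose e := Num.min eps (1 / 2).
have e0 : 0 < e by rewrite lt_min heps /=; lra.
have [ee e12] : e <= eps /\ e <= 1 / 2 by rewrite !ge_min !lexx orbT.
have e20 : 0 < e / 2 by lra.
have [c c0 Hc] := cnt_density k e20.
(* If every nonzero [d] failed, the mean of [Phi] would be at least [4 * eta] over random shifts and
   at most [2 * eta] over [d], while the two differ by at most [eta]. *)
pose eta := c * (1 / 2) ^+ #|{ffun 'I_k -> bool}| / 4.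
have eta0 : 0 < eta by rewrite divr_gt0// mulr_gt0// exprn_gt0//; lra.
have [n [K HK]] := @threshold R ((1 - e) / 2) ((1 - e / 2) / 2) eta
  ltac:(lra) ltac:(lra) ltac:(lra) eta0.
(* Bounds the coefficients of [Phi] as a polynomial in the counts, independently of [p] and [A]. *)
pose C : R := (1 + (1 + 1) ^+ K) ^+ #|{ffun 'I_k -> bool}|.
have C0 : 0 < C by rewrite exprn_gt0// addr_gt0// exprn_gt0// addr_gt0.
pose delta := eta / C; have delta0 : 0 < delta by rewrite divr_gt0.
pose D := (\max_(i < k) size (P i))%N.
have [p1 Hp1] := @poly_indep_real R k D delta delta0.
have [p2 Hp2] := indep_mod hfree hP0.
exists (maxn p1 (maxn p2 (Num.bound eta^-1))) => p pp.
rewrite !geq_max => /andP[p1p /andP[p2p bp]] A alpha.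
have alphaE : alpha = dens R A by rewrite /alpha avg_setT.
pose Q i : {poly 'F_p} := map_poly (intr : int -> 'F_p) (P i).
have sQ i : (size (Q i) <= D.+1)%N.
  by rewrite (leq_trans (size_poly _ _))// leqW// (leq_bigmax i).
have QE g0 g := Hp1 p pp p1p Q g0 g (Hp2 p pp p2p) sQ.
pose T (w : {ffun 'I_k -> bool}) := alpha ^+ (1 + \sum_(i < k) w i).
have T01 w : 0 <= T w <= 1 by rewrite /T alphaE dens_pow_01.
(* Rescales the excess of the count over [T w] to [[0, 1]]: [- e] goes to [(1 - e) / 2] and
   [- (e / 2)] to [(1 - e / 2) / 2], the two thresholds. *)
pose u (w : {ffun 'I_k -> bool}) r := (1 + cnt R A w r - T w) / 2.
pose phi (w : {ffun 'I_k -> bool}) r := 1 - (1 - u w r ^+ n) ^+ K.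
have u01 w r : 0 <= u w r <= 1.
  have := T01 w; have := cnt_01 R A w r; rewrite /u => /andP[? ?] /andP[? ?].
  by apply/andP; split; lra.
have [|nex] := boolP [exists d : 'F_p, (d != 0) &&
    [forall w : {ffun 'I_k -> bool}, T w - e <= cnt R A w (polyval Q d)]].
  case/existsP => d /andP[d0 /forallP Hd]; exists d; split=> // omega.
  have := Hd (finfun omega); rewrite avg_setT /T.
  under eq_bigr do rewrite ffunE.
  have -> : cnt R A (finfun omega) (polyval Q d) = mean (fun x => ind R A x *
      \prod_(i < k) ind R A (x + evalp (P i) d) ^+ omega i).
    apply: eq_mean => x; congr (_ * _); apply: eq_bigr => i _.
    by rewrite ffunE nth_polyval.
  by apply: le_trans; rewrite lerB.
exfalso.
pose Phi r := \prod_(w <- enum {ffun 'I_k -> bool}) phi w r.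
have phi01 w r : 0 <= phi w r <= 1 by have [] := HK _ (u01 w r).
have nphi w : cntpoly k A (1 + (1 + 1) ^+ K) (phi w).
  have nu : cntpoly k A 1 (u w).
    have -> : u w = fun r => 1 / 2 * cnt R A w r + (1 - T w) / 2.
      by apply: funext => r; rewrite /u; lra.
    apply: cntpoly_le (cntpolyD (cntpolyM (cntpoly_cst k A (1 / 2))
      (cntpoly_cnt R A w)) (cntpoly_cst k A ((1 - T w) / 2))) _.
    have /andP[t0 t1] := T01 w.
    by rewrite !ger0_norm; lra.
  rewrite /phi; have n1 : cntpoly k A (1 : R) (fun _ => 1).
    by rewrite -[X in cntpoly _ _ X _]normr1; apply: cntpoly_cst.
  apply: cntpolyD => //; apply: cntpolyN; apply: cntpolyX; apply: cntpolyD => //.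
  by apply: cntpolyN; have := cntpolyX n nu; rewrite expr1n.
have nPhi : cntpoly k A C Phi by rewrite /C cardE; apply: cntpoly_prod.
have le_diff := cntpoly_matching QE (ltW delta0) nPhi.
have Cd : C * delta = eta by rewrite /delta mulrCA divff ?mulr1// gt_eqF.
have low : 4 * eta <= Es k Phi.
  have -> : 4 * eta = (1 / 2) ^+ #|{ffun 'I_k -> bool}| * c by rewrite /eta mulrC divfK ?pnatr_eq0// mulrC.
  apply: le_trans (ler_wpM2l _ (Hc p A)) _; first by rewrite exprn_ge0//; lra.
  rewrite -EsMl; apply: ler_Es => r _; case: (boolP [forall w, _]) => [/forallP Hr|_].
    rewrite mulr1 /Phi cardE -[X in X <= _](_ : \prod_(w <- enum {ffun 'I_k -> bool}) (1 / 2) = _); last first.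
      by rewrite big_const_seq count_predT iter_mulr_1.
    apply: ler_prod => w _; apply/andP; split; first lra.
    have [_ _] := HK _ (u01 w r); apply.
    by have := Hr w; rewrite -alphaE -/(T w) /u; lra.
  by rewrite mulr0 prodr_ge0// => w _; have /andP[] := phi01 w r.
have up : mean (fun d => Phi (polyval Q d)) <= eta + eta.
  apply: (@le_trans _ _ (mean (fun d : 'F_p => eta + (d == 0)%:R))); last first.
    rewrite meanD (mean_cst (Fp_gt0 p)) mean_eq1 card_Fp// lerD2l.
    rewrite invf_ple ?posrE ?ltr0n ?prime_gt0//; apply: ltW.
    apply: lt_le_trans (archi_boundP _) _; first by rewrite invr_ge0 ltW.
    by rewrite ler_nat.
  (* The point [d = 0] costs at most [1 / p <= eta]; at any other [d] some pattern fails, and its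
     factor alone is at most [eta]. *)
  apply: ler_mean => d; have [->|d0] := eqVneq d 0.
    apply: (@le_trans _ _ 1); last by rewrite lerDr ltW.
    by rewrite prodr_ile1// => w _; apply: phi01.
  rewrite addr0; move: nex; rewrite negb_exists => /forallP/(_ d).
  rewrite d0 /= negb_forall => /existsP[w]; rewrite -ltNge => ltw.
  rewrite /Phi (big_rem w) ?mem_enum//=.
  have [_ ua _] := HK _ (u01 w (polyval Q d)).
  rewrite -[leRHS]mulr1 ler_pM//.
  - by have /andP[] := phi01 w (polyval Q d).
  - by rewrite prodr_ge0// => w' _; have /andP[] := phi01 w' (polyval Q d).
  - by apply: ua; move: ltw; rewrite /u; lra.
  - by rewrite prodr_ile1// => w' _; apply: phi01.
by move: le_diff; rewrite Cd ler_distl => /andP[le_diff _]; lra.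
Qed.
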